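(* Let $K$ be a simplicial complex and let $\mathcal{U}$ be a good cover of $K$ by subcomplexes. Let $P_K$ denote the face poset of $K$ and $P_{N\mathcal{U}}$ the face poset of the nerve $N\mathcal{U}$. Let $\tilde{R} \subseteq P_K \times P_{N\mathcal{U}}$ be the covering relation, and let $P_K \star_{\tilde{R}} P_{N\mathcal{U}}^{\mathrm{op}}$ be the relational join poset. Then the inclusion maps of posets $$P_K \xrightarrow{i} P_K \star_{\tilde{R}} P_{N\mathcal{U}}^{\mathrm{op}} \xleftarrow{j} P_{N\mathcal{U}}^{\mathrm{op}}$$ induce homotopy equivalences $$\|\Delta P_K\| \xrightarrow{\simeq} \|\Delta(P_K \star_{\tilde{R}} P_{N\mathcal{U}}^{\mathrm{op}})\| \xleftarrow{\simeq} \|\Delta P_{N\mathcal{U}}^{\mathrm{op}}\|.$$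
   Context: The face poset $P_K$ of a simplicial complex $K$ is the set of its (non-empty) simplices ordered by inclusion. For a poset $P$, the order complex $\Delta P$ is the abstract simplicial complex whose $k$-simplices are the chains $p_0 < \cdots < p_k$ in $P$; $\|\cdot\|$ denotes geometric realization, and $P^{\mathrm{op}}$ is the poset with reversed order. A cover $\mathcal{U}$ of $K$ by subcomplexes is good if every non-empty finite intersection of its elements is contractible. The nerve $N\mathcal{U}$ is the simplicial complex whose simplices are the non-empty finite subsets of $\mathcal{U}$ with non-empty common intersection. The covering relation is: $\sigma \tilde{R} \tau$ if and only if the simplex $\sigma$ of $K$ belongs to every cover element in $\tau$. For a relation $\tilde{R} \subseteq P \times Q$ between disjoint posets (a downward closed subset of the product poset), the relational join poset $P \star_{\tilde{R}} Q^{\mathrm{op}}$ has underlying set the disjoint union of $P$ and $Q^{\mathrm{op}}$, with order: for $p,p' \in P$, $p \le p'$ iff $p \le p'$ in $P$; for $q,q' \in Q^{\mathrm{op}}$, $q \le q'$ iff $q \le q'$ in $Q^{\mathrm{op}}$ (i.e. $q' \le q$ in $Q$); for $p \in P$, $q \in Q^{\mathrm{op}}$, $p \le q$ iff $p\tilde{R}q$ (and never $q \le p$). *)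

(* Defs.v *)
From HB Require Import structures.
From mathcomp Require Import all_boot all_order all_algebra finmap.
From mathcomp Require Import all_classical all_reals topology normedtype.

Set Implicit Arguments.
Unset Strict Implicit.
Unset Printing Implicit Defensive.

Import Order.TTheory GRing.Theory Num.Theory.
Import numFieldTopology.Exports numFieldNormedType.Exports.

Local Open Scope classical_set_scope.
Local Open Scope ring_scope.

(* A homotopy is a continuous map X * [0, 1] -> Y; its values at times outside
   of [0, 1] are irrelevant. *)
Definition homotopic (R : realType) (X Y : topologicalType) (f g : X -> Y) :=
  exists H : X * R -> Y,
    [/\ {within [set p : X * R | 0 <= p.2 <= 1], continuous H},
        forall x, H (x, 0) = f x
      & forall x, H (x, 1) = g x].

Definition homotopy_equivalence (R : realType) (X Y : topologicalType)
    (f : X -> Y) :=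
  continuous f /\
  exists g : Y -> X,
    [/\ continuous g, homotopic R (g \o f) idfun & homotopic R (f \o g) idfun].

Definition contractible (R : realType) (X : topologicalType) :=
  exists x0 : X, homotopic R (@idfun X) (fun=> x0).

(* Simplices are non-empty; K need be neither finite nor finite dimensional, and
   elements of V need not be vertices of K. *)
Record simplicialComplex (V : choiceType) := SimplicialComplex {
  simplices :> set {fset V} ;
  simplex_neq0 : forall s, simplices s -> s != fset0 ;
  simplex_face : forall s t : {fset V},
    simplices s -> (t `<=` s)%fset -> t != fset0 -> simplices t }.

HB.instance Definition _ (V : choiceType) := gen_eqMixin (simplicialComplex V).
HB.instance Definition _ (V : choiceType) :=
  gen_choiceMixin (simplicialComplex V).

Record simplicialMap (V W : choiceType)
    (K : simplicialComplex V) (L : simplicialComplex W) := SimplicialMap {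
  simplicial_fun :> V -> W ;
  simplicial_funP : forall s : {fset V},
    simplices K s -> simplices L (simplicial_fun @` s)%fset }.

(* Points of ||K||, in barycentric coordinates. *)
Record realization (R : realType) (V : choiceType) (K : simplicialComplex V) :=
  Realization {
    coords :> {fsfun V -> R with 0} ;
    coords_ge0 : forall v, 0 <= coords v ;
    coords_sum1 : \sum_(v <- finsupp coords) coords v = 1 ;
    coords_simplex : simplices K (finsupp coords) }.

HB.instance Definition _ (R : realType) (V : choiceType)
  (K : simplicialComplex V) := gen_eqMixin (realization R K).
HB.instance Definition _ (R : realType) (V : choiceType)
  (K : simplicialComplex V) := gen_choiceMixin (realization R K).

Section RealizationTopology.
Context (R : realType) (V : choiceType) (K : simplicialComplex V).

Definition closed_simplex (s : {fset V}) : set (realization R K) :=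
  [set x | (finsupp x `<=` s)%fset].

(* The weak (coherent) topology: a set is open when its trace on every closed
   simplex |s| is open for the Euclidean topology of |s|, given here by the
   sup metric in barycentric coordinates. *)
Definition weak_open (A : set (realization R K)) :=
  forall s : {fset V}, simplices K s ->
  forall x, A x -> closed_simplex s x ->
  exists2 e : R, 0 < e &
    forall y, closed_simplex s y ->
      (forall v, v \in s -> `|x v - y v| < e) -> A y.

Lemma weak_openT : weak_open setT.
Proof. by move=> s _ x _ _; exists 1. Qed.

Lemma weak_openI : setI_closed weak_open.
Proof.
move=> A B oA oB s Ks x [Ax Bx] sx.
have [e e0 eA] := oA s Ks x Ax sx; have [d d0 dB] := oB s Ks x Bx sx.
exists (Num.min e d); first by rewrite lt_min e0.
move=> y sy xy; split; [apply: eA|apply: dB] => // v vs.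
  by have := xy v vs; rewrite lt_min => /andP[].
by have := xy v vs; rewrite lt_min => /andP[].
Qed.

Lemma weak_open_bigU (I : Type) (f : I -> set (realization R K)) :
  (forall i, weak_open (f i)) -> weak_open (\bigcup_i f i).
Proof.
move=> of_ s Ks x [i _ fix_] sx; have [e e0 ef] := of_ i s Ks x fix_ sx.
by exists e => // y sy xy; exists i => //; exact: ef.
Qed.

HB.instance Definition _ := isOpenTopological.Build (realization R K)
  weak_openT weak_openI weak_open_bigU.

End RealizationTopology.

Section RealizationMap.
Context (R : realType) (V W : choiceType).
Context (K : simplicialComplex V) (L : simplicialComplex W).
Context (f : simplicialMap K L).

Fact pushforward_key : unit. Proof. exact: tt. Qed.

(* The affine extension of f: the coordinate of the image at w is the sum of
   the coordinates of x over the fibre of f at w. *)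
Definition pushforward (x : realization R K) : {fsfun W -> R with 0} :=
  [fsfun[pushforward_key] w in (f @` finsupp x)%fset =>
    \sum_(v <- finsupp x | f v == w) x v].

Lemma pushforwardE (x : realization R K) (w : W) :
  pushforward x w = \sum_(v <- finsupp x | f v == w) x v.
Proof.
rewrite fsfunE; case: ifPn => // wx.
rewrite big_seq_cond big_pred0// => v; apply/negbTE/negP => /andP[vx /eqP fv].
by move/negP: wx; apply; rewrite -fv in_imfset.
Qed.

Lemma pushforward_ge0 (x : realization R K) w : 0 <= pushforward x w.
Proof. by rewrite pushforwardE sumr_ge0// => v _; exact: coords_ge0. Qed.

Lemma finsupp_pushforward (x : realization R K) :
  finsupp (pushforward x) = (f @` finsupp x)%fset.
Proof.
apply/fsetP => w; apply/idP/idP.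
  by rewrite mem_finsupp fsfunE; case: ifP => // _; rewrite eqxx.
move=> /imfsetP[v /= vx ->]; rewrite mem_finsupp pushforwardE.
rewrite big_mkcond (big_fsetD1 v)//= eqxx gt_eqF// ltr_wpDr//.
  by rewrite sumr_ge0// => u _; case: ifP => // _; exact: coords_ge0.
by rewrite lt_def coords_ge0 andbT -mem_finsupp.
Qed.

Lemma pushforward_sum1 (x : realization R K) :
  \sum_(w <- finsupp (pushforward x)) pushforward x w = 1.
Proof.
rewrite finsupp_pushforward -(coords_sum1 x).
under eq_bigr do rewrite pushforwardE big_mkcond.
rewrite exchange_big/= big_seq [RHS]big_seq; apply: eq_bigr => v vx.
rewrite (big_fsetD1 (f v)) ?in_imfset//= eqxx big_seq big1 ?addr0// => w.
by rewrite !inE eq_sym => /andP[/negPf ->].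
Qed.

Lemma pushforward_simplex (x : realization R K) :
  simplices L (finsupp (pushforward x)).
Proof.
by rewrite finsupp_pushforward; apply: simplicial_funP; exact: coords_simplex.
Qed.

Definition realization_map (x : realization R K) : realization R L :=
  Realization (pushforward_ge0 x) (pushforward_sum1 x) (pushforward_simplex x).

End RealizationMap.
Arguments realization_map R {V W K L} f x.

Section FacePoset.
Context (V : choiceType) (K : simplicialComplex V).

Definition face_poset := {s : {fset V} | s \in simplices K}.

HB.instance Definition _ := Choice.on face_poset.

Definition face_le (s t : face_poset) := (sval s `<=` sval t)%fset.

Lemma face_le_refl : reflexive face_le.
Proof. by move=> s; exact: fsubset_refl. Qed.

Lemma face_le_anti : antisymmetric face_le.
Proof. by move=> s t st; apply/val_inj/eqP; rewrite eqEfsubset. Qed.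

Lemma face_le_trans : transitive face_le.
Proof. by move=> t s u; exact: fsubset_trans. Qed.

Fact face_display : Order.disp_t. Proof. exact: Order.Disp tt tt. Qed.

HB.instance Definition _ := Order.Le_isPOrder.Build face_display face_poset
  face_le_refl face_le_anti face_le_trans.

End FacePoset.

Section OrderComplex.
Context d (P : porderType d).

Definition chains : set {fset P} :=
  [set c | c != fset0 /\ {in c &, forall x y, (x >=< y)%O}].

Lemma chains_neq0 c : chains c -> c != fset0.
Proof. by case. Qed.

Lemma chains_face (c c' : {fset P}) :
  chains c -> (c' `<=` c)%fset -> c' != fset0 -> chains c'.
Proof.
move=> [_ cP] /fsubsetP c'c c'0; split=> // x y xc' yc'.
by apply: cP; exact: c'c.
Qed.

Definition order_complex := SimplicialComplex chains_neq0 chains_face.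

End OrderComplex.
Arguments order_complex {d} P.

Section OrderComplexMap.
Context d d' (P : porderType d) (Q : porderType d') (f : {omorphism P -> Q}).

Lemma omorphism_simplicial (c : {fset P}) :
  simplices (order_complex P) c -> simplices (order_complex Q) (f @` c)%fset.
Proof.
move=> [/fset0Pn[x xc] cP]; split.
  by apply/fset0Pn; exists (f x); rewrite in_imfset.
move=> _ _ /imfsetP[y /= yc ->] /imfsetP[z /= zc ->].
by have /orP[/(omorph_le f) yz|/(omorph_le f) zy] := cP _ _ yc zc;
  apply/orP; [left|right].
Qed.

Definition order_complex_map : simplicialMap (order_complex P) (order_complex Q)
  := SimplicialMap omorphism_simplicial.

End OrderComplexMap.

Record posetRelation d d' (P : porderType d) (Q : porderType d') :=
  PosetRelation {
    rel_graph :> set (P * Q) ;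
    rel_graph_down : forall p p' q q', (p' <= p)%O -> (q' <= q)%O ->
      rel_graph (p, q) -> rel_graph (p', q') }.

(* The carrier does not depend on r, but its canonical order below does. *)
Definition relational_join d d' (P : porderType d) (Q : porderType d')
  (r : posetRelation P Q) : Type := (P + Q^d)%type.

Section RelationalJoin.
Context d d' (P : porderType d) (Q : porderType d') (r : posetRelation P Q).

HB.instance Definition _ := Choice.copy (relational_join r) (P + Q^d)%type.

Definition rjoin_le (x y : relational_join r) : bool :=
  match x, y with
  | inl p, inl p' => (p <= p')%O
  | inr q, inr q' => (q <= q')%O
  | inl p, inr q => (p, q : Q) \in (r : set (P * Q))
  | inr _, inl _ => false
  end.

Lemma rjoin_le_refl : reflexive rjoin_le.
Proof. by case=> a /=; exact: lexx. Qed.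

Lemma rjoin_le_anti : antisymmetric rjoin_le.
Proof. by move=> [p|q] [p'|q']/=; rewrite ?andbF // => /le_anti ->. Qed.

Lemma rjoin_le_trans : transitive rjoin_le.
Proof.
move=> [b|b] [a|a] [c|c]//=; try exact: le_trans.
- by move=> ab; rewrite !inE; exact: rel_graph_down.
- by rewrite !inE => rab bc; apply: rel_graph_down rab.
Qed.

Fact rjoin_display : Order.disp_t. Proof. exact: Order.Disp tt tt. Qed.

HB.instance Definition _ := Order.Le_isPOrder.Build rjoin_display
  (relational_join r) rjoin_le_refl rjoin_le_anti rjoin_le_trans.

Definition rjoin_inl (p : P) : relational_join r := inl p.
Definition rjoin_inr (q : Q^d) : relational_join r := inr q.

Lemma rjoin_inl_homo : {homo rjoin_inl : p p' / (p <= p')%O}.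
Proof. by []. Qed.

Lemma rjoin_inr_homo : {homo rjoin_inr : q q' / (q <= q')%O}.
Proof. by []. Qed.

HB.instance Definition _ := Order.isOrderMorphism.Build d P
  rjoin_display (relational_join r) rjoin_inl rjoin_inl_homo.
HB.instance Definition _ := Order.isOrderMorphism.Build _ Q^d
  rjoin_display (relational_join r) rjoin_inr rjoin_inr_homo.

End RelationalJoin.
Arguments rjoin_inl {d d' P Q} r p.
Arguments rjoin_inr {d d' P Q} r q.

Section Covers.
Context (V : choiceType).
Implicit Types (K L : simplicialComplex V) (U : set (simplicialComplex V)).
Implicit Types (F : {fset simplicialComplex V}).

Definition common_simplices F : set {fset V} :=
  [set s | s != fset0 /\ forall L, L \in F -> simplices L s].

Lemma common_simplices_neq0 F s : common_simplices F s -> s != fset0.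
Proof. by case. Qed.

Lemma common_simplices_face F (s t : {fset V}) : common_simplices F s ->
  (t `<=` s)%fset -> t != fset0 -> common_simplices F t.
Proof.
move=> [_ Fs] ts t0; split=> // L LF.
by apply: simplex_face (Fs _ LF) ts t0.
Qed.

Definition intersection_complex F : simplicialComplex V :=
  SimplicialComplex (@common_simplices_neq0 F) (@common_simplices_face F).

Definition is_cover K U :=
  (forall L, U L -> L `<=` K) /\ \bigcup_(L in U) L = K.

Definition good_cover (R : realType) K U :=
  is_cover K U /\
  forall F, F != fset0 -> [set` F] `<=` U -> simplices (intersection_complex F) !=set0 ->
    contractible R (realization R (intersection_complex F)).

Definition nerve_simplices U : set {fset simplicialComplex V} :=
  [set F | [/\ F != fset0, [set` F] `<=` U & simplices (intersection_complex F) !=set0]].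

Lemma nerve_simplices_neq0 U F : nerve_simplices U F -> F != fset0.
Proof. by case. Qed.

Lemma nerve_simplices_face U F F' : nerve_simplices U F ->
  (F' `<=` F)%fset -> F' != fset0 -> nerve_simplices U F'.
Proof.
move=> [_ FU [s [s0 Fs]]] /fsubsetP F'F F'0; split=> //.
- by move=> L /F'F; exact: FU.
- by exists s; split=> // L /F'F; exact: Fs.
Qed.

Definition nerve U : simplicialComplex (simplicialComplex V) :=
  SimplicialComplex (@nerve_simplices_neq0 U) (@nerve_simplices_face U).

Section CoveringRelation.
Context (K : simplicialComplex V) (U : set (simplicialComplex V)).

Definition covering_graph : set (face_poset K * face_poset (nerve U)) :=
  [set st | forall L, L \in sval st.2 -> simplices L (sval st.1)].

Lemma covering_graph_down (p p' : face_poset K) (q q' : face_poset (nerve U)) :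
  (p' <= p)%O -> (q' <= q)%O -> covering_graph (p, q) ->
  covering_graph (p', q').
Proof.
move=> p'p /fsubsetP q'q pq L /q'q /pq Lp; apply: simplex_face Lp p'p _.
by have := valP p'; rewrite inE; exact: simplex_neq0.
Qed.

Definition covering_relation : posetRelation (face_poset K)
    (face_poset (nerve U)) :=
  PosetRelation covering_graph_down.

End CoveringRelation.
End Covers.

(* Main.v *)
Require Import Defs.
From mathcomp Require Import all_boot all_order all_algebra finmap.
From mathcomp Require Import all_classical all_reals topology normedtype.
From mathcomp Require Import lra.

(* Both inclusions are instances of Quillen's fiber lemma. For i the fiber over
   q in P_NU^op is the face poset of the intersection of the members of q, which
   is contractible because the cover is good and because ||Delta P_L|| is
   dominated by ||L||; for j, with the order reversed, the fiber over a simplex p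
   is the face poset of the full simplex on the members of U containing p.

   The complexes are infinite, so the fiber lemma is proved by an explicit
   construction rather than by gluing cells. Assign to each element v of the
   join poset J a subspace C_v of ||Delta J||, increasing in v, with a contraction
   c_v to a point. A point of the realization with support v_1 < ... < v_n is
   then sent into C_(v_n) by contracting successively along c_(v_1), ..., c_(v_n),
   for times given by the ratio of the weight of v_k to the weight below v_k;
   this is continuous and compatible with faces. Taking for C_v the fiber under v
   gives a map r to the subcomplex. Performing the same construction on
   J x {false < true}, with C_(v, false) the fiber and C_(v, true) the cone of all
   elements below v, and composing with the prism map
   ||Delta J|| x [0, 1] -> ||Delta (J x {false < true})||, gives a homotopy from r
   to a map which does not enlarge supports, hence is homotopic to the
   identity. *)

Set Implicit Arguments.
Unset Strict Implicit.
Unset Printing Implicit Defensive.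

Import Order.TTheory GRing.Theory Num.Theory.
Import numFieldTopology.Exports numFieldNormedType.Exports.

Local Open Scope classical_set_scope.
Local Open Scope ring_scope.

(** * Limits of maxima, minima and finite sums *)

Lemma cvg_maxr (R : realType) T (F : set_system T) (FF : Filter F)
    (f g : T -> R) (a b : R) :
  f @ F --> a -> g @ F --> b -> (fun t => Num.max (f t) (g t)) @ F --> Num.max a b.
Proof.
move=> fa gb; rewrite maxr_absE.
under eq_fun do rewrite maxr_absE.
by apply: cvgM; [apply: cvgD; [exact: cvgD|apply: cvg_norm; exact: cvgB]|exact: cvg_cst].
Qed.

Lemma cvg_minr (R : realType) T (F : set_system T) (FF : Filter F)
    (f g : T -> R) (a b : R) :
  f @ F --> a -> g @ F --> b -> (fun t => Num.min (f t) (g t)) @ F --> Num.min a b.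
Proof.
move=> fa gb; rewrite minr_absE.
under eq_fun do rewrite minr_absE.
by apply: cvgM; [apply: cvgB; [exact: cvgD|apply: cvg_norm; exact: cvgB]|exact: cvg_cst].
Qed.

Lemma cvg_sumr (R : realType) T (F : set_system T) (FF : Filter F) (I : choiceType)
    (s : seq I) (P : pred I) (f : I -> T -> R) (a : I -> R) :
  (forall i, i \in s -> P i -> f i @ F --> a i) ->
  (fun t => \sum_(i <- s | P i) f i t) @ F --> \sum_(i <- s | P i) a i.
Proof.
elim: s => [|i s IH] fa.
  by under eq_fun do rewrite big_nil; rewrite big_nil; exact: cvg_cst.
under eq_fun do rewrite big_cons; rewrite big_cons.
have cs : (fun t => \sum_(i <- s | P i) f i t) @ F --> \sum_(i <- s | P i) a i.
  by apply: IH => j js; apply: fa; rewrite inE js orbT.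
case: ifPn => // Pi; apply: cvgD => //; apply: fa => //; exact: mem_head.
Qed.

Lemma near_fset (I : choiceType) (D : {fset I}) T (F : set_system T)
    (FF : Filter F) (P : I -> T -> Prop) :
  (forall i, i \in D -> \forall t \near F, P i t) ->
  \forall t \near F, forall i, i \in D -> P i t.
Proof. exact: filter_bigI. Qed.

(** * The weak topology *)

Section Euclid.
Context (R : realType) (V : choiceType) (K : simplicialComplex V).
Implicit Types (s : {fset V}) (x y : realization R K).

(** Euclidean neighbourhoods of [x] inside the single closed simplex |s|. Questions about the weak
    topology are reduced to convergence along these filters, one simplex at a time. *)
Definition euclid s x : set_system (realization R K) :=
  filter_from [set e : R | 0 < e]
    (fun e => [set y | closed_simplex s y /\
                       forall v, v \in s -> `|x v - y v| < e]).

Global Instance euclid_filter s x : Filter (euclid s x).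
Proof.
apply: filter_from_filter; first by exists 1 => /=.
move=> d e /= d0 e0; exists (Num.min d e); first by rewrite /= lt_min d0.
move=> y [sy xy]; split; split=> // v vs; have := xy v vs;
  by rewrite lt_min => /andP[].
Qed.

Lemma coords_out s x v : closed_simplex s x -> v \notin s -> x v = 0.
Proof.
move=> /fsubsetP sx; apply: contraNeq => xv; apply: sx; by rewrite mem_finsupp.
Qed.

Lemma euclid_closed s x : \forall y \near euclid s x, closed_simplex s y.
Proof. by exists 1 => //= y []. Qed.

Lemma coords_gt0 x v : (0 < x v) = (v \in finsupp x).
Proof. by rewrite mem_finsupp lt_def coords_ge0 andbT. Qed.

Lemma coords_le1 x v : x v <= 1.
Proof.
have [vx|vx] := boolP (v \in finsupp x); last first.
  by move: vx; rewrite mem_finsupp negbK => /eqP ->.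
rewrite -(coords_sum1 x) (big_fsetD1 v) //= lerDl sumr_ge0 // => u _.
exact: coords_ge0.
Qed.

Lemma sum_coords s x : closed_simplex s x -> \sum_(v <- s) x v = 1.
Proof.
move=> sx; rewrite -(coords_sum1 x); apply/esym/big_fset_incl => // v vs.
by rewrite mem_finsupp negbK => /eqP.
Qed.

Lemma realization_eq x y : (forall v, x v = y v) -> x = y.
Proof.
case: x y => [x ? ? ?] [y ? ? ?] /= xy.
have {}xy : x = y by apply/fsfunP.
by subst y; congr Realization; exact: Prop_irrelevance.
Qed.

Lemma finsupp_neq0 x : exists v, v \in finsupp x.
Proof. exact/fset0Pn/(simplex_neq0 (coords_simplex x)). Qed.

Lemma cvg_coords s x v : closed_simplex s x -> (fun y => y v) @ euclid s x --> x v.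
Proof.
move=> sx; apply/cvgrPdist_lt => e e0.
have [vs|vs] := boolP (v \in s); first by exists e => //= y [_]; exact.
near=> y; rewrite (coords_out sx) // (@coords_out s y) // ?subrr ?normr0 //.
by near: y; exact: euclid_closed.
Unshelve. all: by end_near.
Qed.

(* Only the finitely many subsets of s can support F t. *)
Lemma cvg_realization T (G : set_system T) (FG : Filter G)
    (F : T -> realization R K) s x :
  closed_simplex s x ->
  (\forall t \near G, closed_simplex s (F t)) ->
  (forall v, v \in s -> (fun t => F t v) @ G --> x v) -> F @ G --> x.
Proof.
move=> sx sF Fx.
suff H (O : set (realization R K)) : open O -> O x -> \forall t \near G, O (F t).
  by move=> O; rewrite nbhsE => -[O' [oO' O'x] O'O]; apply: filterS (H _ oO' O'x) => t /O'O.
move=> oO Ox.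
have near1 s' : s' \in fpowerset s -> \forall t \near G,
    simplices K s' -> closed_simplex s' x -> closed_simplex s' (F t) -> O (F t).
  rewrite fpowersetE => /fsubsetP s's.
  have [Ks'|] := pselect (simplices K s'); last by move=> n; near=> t => /n.
  have [s'x|] := pselect (closed_simplex s' x); last by move=> n; near=> t => _ /n.
  have [e e0 eO] := oO _ Ks' _ Ox s'x.
  have : \forall t \near G, forall v, v \in s' -> `|x v - F t v| < e.
    apply: near_fset => v vs'; have /cvgrPdist_lt := Fx _ (s's _ vs'); exact.
  by apply: filterS => t xt _ _ s't; exact: eO.
(* Coordinates positive at [x] stay positive, so the support of [F t] eventually contains that of
   [x]. This makes it one of the faces [s'] to which [near1] applies. *)
have near2 : \forall t \near G, forall v, v \in s -> v \in finsupp x -> v \in finsupp (F t).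
  apply: near_fset => v vs.
  have [vx|] := boolP (v \in finsupp x); last by move=> _; near=> t.
  near=> t => _; rewrite -coords_gt0; near: t.
  by apply: (cvgr_gt _ (Fx v vs)); rewrite coords_gt0.
have := near_fset FG near1.
apply: filterS3 sF near2 => t sFt xFt H.
apply: (H (finsupp (F t))) => //; rewrite /=.
- by rewrite fpowersetE.
- exact: coords_simplex.
- by apply/fsubsetP => v vx; apply: xFt => //; exact: (fsubsetP sx).
- exact: fsubset_refl.
Unshelve. all: by end_near.
Qed.

(** The condition is imposed at every point of [A], so [A] is itself weakly open. *)
Lemma euclid_nbhs (A : set (realization R K)) x : A x ->
  (forall s y, simplices K s -> closed_simplex s y -> A y ->
    \forall z \near euclid s y, A z) -> nbhs x A.
Proof.
move=> Ax H; have oA : weak_open A.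
  move=> s Ks y Ay sy; have [e e0 eA] := H s y Ks sy Ay.
  by exists e => // z sz yz; apply: eA.
by rewrite nbhsE; exists A.
Qed.

Lemma continuous_realization (Y : topologicalType) (f : realization R K -> Y) :
  (forall s x, simplices K s -> closed_simplex s x -> f @ euclid s x --> f x) ->
  continuous f.
Proof.
move=> H x O nO; suff oO : weak_open (f @^-1` O^°).
  apply: (@filterS _ _ _ (f @^-1` O^°)); first by move=> y; exact: interior_subset.
  by apply: open_nbhs_nbhs; split.
move=> s Ks y Oy sy; have [e e0 eO] := H s y Ks sy O^° (nbhs_interior Oy).
by exists e => // z sz yz; apply: eO.
Qed.

Lemma continuous_coords v : continuous (fun x : realization R K => x v).
Proof. by apply: continuous_realization => s x _; exact: cvg_coords. Qed.

(* Compactness of [0, 1] makes ||K|| x [0, 1] carry the weak topology with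
   respect to the products |s| x [0, 1]. *)
Lemma continuous_prism (Y : topologicalType) (C : set (realization R K))
    (H : realization R K * R -> Y) :
  (forall s x, closed_simplex s x -> ~ C x -> \forall y \near euclid s x, ~ C y) ->
  (forall s x (t : R), simplices K s -> closed_simplex s x -> C x -> 0 <= t <= 1 ->
    H @ filter_prod (within C (euclid s x))
          (within [set u : R | 0 <= u <= 1] (nbhs t)) --> H (x, t)) ->
  {within [set p | C p.1 /\ 0 <= p.2 <= 1], continuous H}.
Proof.
move=> clC cH; apply/subspace_continuousP => -[x t] [/= Cx t01].
suff HO (O : set Y) : open O -> O (H (x, t)) -> \forall p \near (x, t),
    C p.1 /\ 0 <= p.2 <= 1 -> O (H p).
  move=> O; rewrite /= nbhsE => -[O' [oO' O'x] O'O].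
  rewrite /within /=; apply: filterS (HO _ oO' O'x) => p Op Cp; exact/O'O/Op.
move=> oO OH.
pose good y u := C y -> 0 <= u <= 1 -> O (H (y, u)).
have gloc s y u : simplices K s -> closed_simplex s y -> C y -> 0 <= u <= 1 -> O (H (y, u)) ->
    \forall y' \near euclid s y & u' \near u, good y' u'.
  move=> Ks sy Cy u01 Oyu; have := cH s y u Ks sy Cy u01 O (open_nbhs_nbhs (conj oO Oyu)).
  move=> [[A B] [/= nA nB] AB]; exists (fun y' => C y' -> A y', fun u' => 0 <= u' <= 1 -> B u').
    by split.
  move=> [y' u'] [/= Ay Bu] Cy' u'01; apply: (AB (y', u')); split; [exact: Ay|exact: Bu].
(* Halving the radius gives a closed interval of good times at [x], to which compactness can be
   applied. *)
have [d d0 dgood] : exists2 d : R, 0 < d & forall u, `|t - u| <= d -> good x u.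
  have := gloc _ x t (coords_simplex x) (fsubset_refl _) Cx t01 OH.
  move=> [[A B] [/= nA nB] AB].
  have /nbhs_ballP[d /= d0 dB] := nB.
  exists (d / 2); first by rewrite divr_gt0.
  move=> u tu; apply: (AB (x, u)); split => /=.
    by case: nA => e /= e0; apply; split; [exact: fsubset_refl|move=> v _; rewrite subrr normr0].
  apply: dB; apply: le_lt_trans tu _; by rewrite ltr_pdivrMr// ltr_pMr// ltr1n.
pose J := `[t - d, t + d]%classic.
(* A tube argument: on each closed simplex, compactness of [J] turns the local statement [gloc] into
   one uniform over all times in [J]. Points off [C] are good vacuously, and [clC] keeps their
   neighbours off [C]. *)
pose W := [set y | forall u, J u -> good y u].
have nW : nbhs x W.
  apply: euclid_nbhs.
    by move=> u; rewrite /J /= in_itv /= => /andP[h1 h2]; apply: dgood;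
      rewrite ler_norml; apply/andP; split; rewrite ?lerBrDr ?lerBlDr ?lerNl; lra.
  move=> s y Ks sy Wy; have [Cy|nCy] := pselect (C y); last first.
    by have := clC s y sy nCy; apply: filterS => z nCz u _ /nCz.
  have /compact_near_coveringP := @segment_compact R (t - d) (t + d).
  move=> /(_ _ (euclid s y) (fun z u => good z u) _); apply => u Ju.
  have [u01|nu01] := boolP (0 <= u <= 1).
    have := gloc s y u Ks sy Cy u01 (Wy u Ju Cy u01).
    move=> [[A B] [/= nA nB] AB]; exists (B, A) => //.
    by move=> [u' y'] [Bu' Ay']; exact: (AB (y', u')).
  (* [J] may leave [0, 1]; there goodness is vacuous, on a whole neighbourhood since [0, 1] is
     closed. *)
  have nu : \forall u' \near u, ~~ (0 <= u' <= 1).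
    suff : nbhs u (~` `[0, 1]%classic : set R).
      by apply: filterS => z /=; rewrite in_itv /= => /negP.
    apply: open_nbhs_nbhs; split; first exact/closed_openC/interval_closed.
    by rewrite /= in_itv /=; exact/negP.
  exists ([set v : R | ~~ (0 <= v <= 1)], setT).
    by split => //; exact: filterT.
  by move=> [u' y'] [/= /negP n01 _] _ /n01.
exists (W, J) => /=.
  split => //=; apply/nbhs_ballP; exists d => //= u; rewrite /ball /J /= in_itv /=.
  by rewrite ltr_norml => /andP[h1 h2]; apply/andP; split; lra.
by move=> [y u] [/= Wy Ju] [Cy u01]; exact: Wy.
Qed.

End Euclid.
Arguments cvg_coords {R V K s x} v _.

Lemma euclid_finsupp (R : realType) (V : choiceType) (K : simplicialComplex V)
    (s : {fset V}) (x : realization R K) v :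
  closed_simplex s x -> v \in finsupp x ->
  \forall y \near euclid s x, v \in finsupp (coords y).
Proof.
move=> sx vx; have := cvgr_gt _ (cvg_coords v sx) 0.
by rewrite coords_gt0 => /(_ _ vx); apply: filterS => y; rewrite coords_gt0.
Qed.

(** * Segments and homotopies *)

Section Prism.
Context (R : realType) (V : choiceType) (K : simplicialComplex V).
Implicit Types (s : {fset V}) (x y : realization R K).

Lemma euclid_le_nbhs s x : simplices K s -> closed_simplex s x -> nbhs x `<=` euclid s x.
Proof.
move=> Ks sx O; rewrite nbhsE => -[O' [oO' O'x] O'O].
have [e e0 eO] := (oO' : weak_open O') s Ks x O'x sx.
by exists e => // y [sy xy]; apply/O'O/eO.
Qed.

Lemma continuous_euclid (Y : topologicalType) (f : realization R K -> Y) s x :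
  continuous f -> simplices K s -> closed_simplex s x -> f @ euclid s x --> f x.
Proof. by move=> cf Ks sx O nO; apply: (euclid_le_nbhs Ks sx); exact: cf. Qed.

Definition prism_filter (C : set (realization R K)) s x (t : R) :=
  filter_prod (within C (euclid s x)) (within [set u : R | 0 <= u <= 1] (nbhs t)).

Global Instance prism_filter_filter C s x t : Filter (prism_filter C s x t).
Proof. exact: filter_prod_filter. Qed.

Lemma prism_fst C s x t : fst @ prism_filter C s x t --> euclid s x.
Proof. by apply: cvg_trans (cvg_within _); exact: cvg_fst. Qed.

Lemma prism_snd C s x t : snd @ prism_filter C s x t --> t.
Proof. by apply: cvg_trans (cvg_within _); exact: cvg_snd. Qed.

Lemma prism_near C s x t : \forall p \near prism_filter C s x t,
  [/\ C p.1, closed_simplex s p.1 & 0 <= p.2 <= 1].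
Proof.
have := @prism_fst C s x t _ (euclid_closed s x).
have : \forall p \near prism_filter C s x t, C p.1 /\ 0 <= p.2 <= 1.
  exists (C, [set u : R | 0 <= u <= 1]) => /=; last by [].
  by split; exact: (@withinT _ (euclid s x)) || exact: (@withinT _ (nbhs t)).
by apply: filterS2 => p [Cp p01].
Qed.

Lemma prism_coords C s x t (v : V) : closed_simplex s x ->
  (fun p : realization R K * R => p.1 v) @ prism_filter C s x t --> x v.
Proof. by move=> sx; exact: (cvg_comp _ _ (@prism_fst _ _ _ _) (cvg_coords v sx)). Qed.

Lemma homotopy_continuous (Y : topologicalType) (H : realization R K * R -> Y) :
  (forall s x (t : R), simplices K s -> closed_simplex s x -> 0 <= t <= 1 ->
    H @ prism_filter setT s x t --> H (x, t)) ->
  {within [set p | 0 <= p.2 <= 1], continuous H}.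
Proof.
move=> cH; have -> : [set p : realization R K * R | 0 <= p.2 <= 1] =
    [set p | setT p.1 /\ 0 <= p.2 <= 1].
  by apply/seteqP; split=> p //= [].
apply: continuous_prism => [s x _ /(_ I) //|s x t Ks sx _]; exact: cH.
Qed.

(** Points of a realization are built by normalizing nonnegative weights on a finite set; what
    remains to check each time is that the vertices of nonzero weight span a simplex. *)
Lemma point_exists s (f : V -> R) : (forall v, v \in s -> 0 <= f v) ->
  (exists2 v, v \in s & 0 < f v) -> simplices K [fset v in s | f v != 0]%fset ->
  exists x : realization R K,
    forall v, x v = (if v \in s then f v else 0) / \sum_(u <- s) f u.
Proof.
move=> f0 [v vs fv] Ks.
have S0 : 0 < \sum_(u <- s) f u.
  rewrite (big_fsetD1 v) //=; apply: ltr_wpDr => //.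
  by rewrite big_seq sumr_ge0 // => u; rewrite !inE => /andP[_]; exact: f0.
pose g : {fsfun V -> R with 0} := [fsfun u in s => f u / \sum_(u <- s) f u].
have gE u : g u = (if u \in s then f u else 0) / \sum_(u <- s) f u.
  by rewrite fsfunE; case: ifP => // _; rewrite mul0r.
have gs : finsupp g = [fset v in s | f v != 0]%fset.
  apply/fsetP => u; rewrite mem_finsupp gE !inE /=; case: ifP => us; last by rewrite mul0r eqxx.
  by rewrite mulf_eq0 invr_eq0 (gt_eqF S0) orbF.
have g0 u : 0 <= g u.
  by rewrite gE; case: ifP => us; rewrite ?mul0r // divr_ge0 ?f0 // ltW.
have g1 : \sum_(u <- finsupp g) g u = 1.
  rewrite (big_fset_incl _ (_ : finsupp g `<=` s)%fset) /=.
  - under eq_big_seq => u us do rewrite gE us.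
    by rewrite -mulr_suml mulfV ?gt_eqF.
  - by rewrite gs; apply/fsubsetP => u; rewrite !inE => /andP[].
  - by move=> u us; rewrite mem_finsupp negbK => /eqP.
have gK : simplices K (finsupp g) by rewrite gs.
by exists (Realization g0 g1 gK).
Qed.

Lemma vertex_exists v : simplices K [fset v]%fset ->
  exists x : realization R K, finsupp x = [fset v]%fset.
Proof.
move=> Kv; have [|||x xE] := @point_exists [fset v]%fset (fun=> 1).
- by [].
- by exists v; rewrite ?inE.
- by rewrite (_ : [fset _ in _ | _]%fset = [fset v]%fset) //; apply/fsetP => u; rewrite !inE /= oner_eq0 andbT.
exists x; apply/fsetP => u; rewrite mem_finsupp xE big_seq_fset1 divr1 inE.
by case: ifP; rewrite ?oner_eq0 ?eqxx.
Qed.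

(* Junk value x when the union of the supports is not a simplex. *)
Definition seg x y (t : R) : realization R K :=
  xget x [set z : realization R K | forall v, z v = (1 - t) * x v + t * y v].

Lemma segE x y t v : 0 <= t <= 1 -> simplices K (finsupp x `|` finsupp y)%fset ->
  seg x y t v = (1 - t) * x v + t * y v.
Proof.
move=> /andP[t0 t1] Kxy; rewrite /seg; case: xgetP => [z _ -> //|noz]; exfalso.
pose s := (finsupp x `|` finsupp y)%fset.
pose f v := (1 - t) * x v + t * y v.
have f0 u : 0 <= f u by rewrite addr_ge0 // mulr_ge0 ?coords_ge0 // subr_ge0.
have sx : closed_simplex s x by exact: fsubsetUl.
have sy : closed_simplex s y by exact: fsubsetUr.
have f1 : \sum_(u <- s) f u = 1.
  by rewrite big_split /= -!mulr_sumr !sum_coords // !mulr1 subrK.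
have [w ws fw] : exists2 w, w \in s & 0 < f w.
  apply/not_exists2P => nf; have : \sum_(u <- s) f u = 0.
    rewrite big_seq big1 // => u us; apply/eqP; rewrite eq_le f0 andbT leNgt.
    by apply/negP; case: (nf u).
  by apply/eqP; rewrite f1 oner_eq0.
have [|||z zE] := @point_exists s f.
- by [].
- by exists w.
- apply: simplex_face Kxy _ _; first by apply/fsubsetP => u; rewrite !inE => /andP[].
  by apply/fset0Pn; exists w; move: ws; rewrite !inE /= (gt_eqF fw) andbT.
apply: (noz z) => u; rewrite zE f1 divr1; case: ifPn => // us.
by rewrite (coords_out sx us) (coords_out sy us) !mulr0 addr0.
Qed.

Lemma seg0 x y : simplices K (finsupp x `|` finsupp y)%fset -> seg x y 0 = x.
Proof.
by move=> Kxy; apply: realization_eq => v; rewrite segE ?lexx ?ler01 // subr0 mul1r mul0r addr0.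
Qed.

Lemma seg1 x y : simplices K (finsupp x `|` finsupp y)%fset -> seg x y 1 = y.
Proof.
by move=> Kxy; apply: realization_eq => v; rewrite segE ?lexx ?ler01 // subrr mul1r mul0r add0r.
Qed.

Lemma finsupp_seg x y t : 0 <= t <= 1 -> simplices K (finsupp x `|` finsupp y)%fset ->
  (finsupp (seg x y t) `<=` finsupp x `|` finsupp y)%fset.
Proof.
move=> t01 Kxy; apply/fsubsetP => v; rewrite mem_finsupp segE // !inE !mem_finsupp.
by apply: contraNT; rewrite negb_or !negbK => /andP[/eqP -> /eqP ->]; rewrite !mulr0 addr0.
Qed.

(** The finite set [s'] bounds all supports that occur, so [cvg_realization] reduces the claim to
    the coordinates, which are polynomial in those of [f], [g] and in the time. *)
Lemma seg_cvg C s s' x (t : R) (f g : realization R K -> realization R K) :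
  closed_simplex s x -> 0 <= t <= 1 ->
  (forall y, C y -> closed_simplex s y ->
    [/\ simplices K (finsupp (f y) `|` finsupp (g y))%fset,
      closed_simplex s' (f y) & closed_simplex s' (g y)]) -> C x ->
  (forall v, (fun y => f y v) @ euclid s x --> f x v) ->
  (forall v, (fun y => g y v) @ euclid s x --> g x v) ->
  (fun p => seg (f p.1) (g p.1) p.2) @ prism_filter C s x t --> seg (f x) (g x) t.
Proof.
move=> sx t01 fg Cx cf cg; have [Kx fx gx] := fg x Cx sx.
have sub y u : C y -> closed_simplex s y -> 0 <= u <= 1 ->
    closed_simplex s' (seg (f y) (g y) u).
  move=> Cy sy u01; have [Ky fy gy] := fg y Cy sy.
  by apply: fsubset_trans (finsupp_seg u01 Ky) _; rewrite fsubUset; apply/andP; split.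
apply: (@cvg_realization _ _ _ _ _ _ _ s').
- exact: sub.
- by apply: filterS (prism_near _ _ _ _) => p [Cp sp p01]; exact: sub.
move=> v _; rewrite segE //.
apply: cvg_trans (_ : (fun p : realization R K * R => (1 - p.2) * f p.1 v + p.2 * g p.1 v) @ prism_filter C s x t --> _).
  apply: near_eq_cvg; apply: filterS (prism_near _ _ _ _) => p [Cp sp p01].
  by have [Kp _ _] := fg p.1 Cp sp; rewrite segE.
have c2 := @prism_snd C s x t.
apply: cvgD; apply: cvgM => //.
- by apply: cvgB => //; exact: cvg_cst.
- exact: (cvg_comp _ _ (@prism_fst _ _ _ _) (cf v)).
- exact: (cvg_comp _ _ (@prism_fst _ _ _ _) (cg v)).
Qed.

(** Both [x] and [f x] lie in the closed simplex carrying [x], so the straight-line homotopy stays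
    in the complex. *)
Lemma homotopic_shrink (f : realization R K -> realization R K) :
  continuous f -> (forall x, (finsupp (f x) `<=` finsupp x)%fset) ->
  homotopic R f idfun /\ homotopic R idfun f.
Proof.
move=> cf fx.
have cfv s x v : simplices K s -> closed_simplex s x ->
    (fun y => f y v) @ euclid s x --> f x v.
  move=> Ks sx; apply: (@continuous_euclid R (fun y => f y v)) => // y.
  apply: (@continuous_comp _ _ _ f (fun y : realization R K => y v)); [exact: cf|exact: continuous_coords].
have Kfx x : simplices K (finsupp (f x) `|` finsupp x)%fset.
  by rewrite (fsetUidPr _ _ (fx x)); exact: coords_simplex.
split.
- exists (fun p => seg (f p.1) p.1 p.2); split; last first.
  + by move=> x; rewrite /= seg1.
  + by move=> x; rewrite /= seg0.
  apply: homotopy_continuous => s x t Ks sx t01.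
  apply: (@seg_cvg _ s s _ _ f id) => //= [y _ sy|v|v].
  + by split => //; exact: fsubset_trans (fx y) sy.
  + exact: cfv.
  + exact: cvg_coords.
- exists (fun p => seg p.1 (f p.1) p.2); split; last first.
  + by move=> x; rewrite /= seg1 // fsetUC.
  + by move=> x; rewrite /= seg0 // fsetUC.
  apply: homotopy_continuous => s x t Ks sx t01.
  apply: (@seg_cvg _ s s _ _ id f) => //= [y _ sy|v|v].
  + by split=> //; rewrite 1?fsetUC //; exact: fsubset_trans (fx y) sy.
  + exact: cvg_coords.
  + exact: cfv.
Qed.

End Prism.

(** * Contractions of subspaces and cones *)

Section Contracts.
Context (R : realType) (Y : topologicalType).

(** A contraction of the subspace [C] to [y], encoded by a map on the ambient space whose values off
    [C] are irrelevant. *)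
Definition contracts (C : set Y) (c : Y * R -> Y) (y : Y) :=
  [/\ C y, forall z t, C z -> 0 <= t <= 1 -> C (c (z, t)),
      forall z, C z -> c (z, 0) = z, forall z, C z -> c (z, 1) = y
    & {within [set p | C p.1 /\ 0 <= p.2 <= 1], continuous c}].

Lemma contracts_contractible c y : contracts setT c y -> contractible R Y.
Proof.
case=> _ _ c0 c1 cc; exists y; exists c; split=> [|x|x]; [|exact: c0|exact: c1].
have -> // : [set p : Y * R | 0 <= p.2 <= 1] = [set p | setT p.1 /\ 0 <= p.2 <= 1].
by apply/seteqP; split=> p //= [].
Qed.

End Contracts.

(** Every simplex with vertices in [B] spans a simplex together with the carrier of [y], so points
    supported in [B] can move to [y] along segments. *)
Lemma cone_contracts (R : realType) (V : choiceType) (K : simplicialComplex V)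
    (B : set V) (y : realization R K) :
  [set` finsupp y] `<=` B ->
  (forall s, simplices K s -> [set` s] `<=` B -> simplices K (s `|` finsupp y)%fset) ->
  contracts [set z : realization R K | [set` finsupp z] `<=` B]
    (fun p => seg p.1 y p.2) y.
Proof.
move=> yB coneK.
have Kz (z : realization R K) : [set` finsupp z] `<=` B ->
    simplices K (finsupp z `|` finsupp y)%fset.
  by apply: coneK; exact: coords_simplex.
split=> //.
- move=> z t zB t01 v /= vz; have /fsubsetP/(_ v vz) := finsupp_seg t01 (Kz z zB).
  by rewrite inE => /orP[/zB|/yB].
- by move=> z /= zB; rewrite seg0 //; exact: Kz.
- by move=> z /= zB; rewrite seg1 //; exact: Kz.
apply: continuous_prism.
  (* Closedness on each simplex: a positive coordinate at a vertex outside [B] stays positive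
     nearby. *)
  move=> s x sx /existsNP[v /not_implyP[/= vx nBv]].
  by apply: filterS (euclid_finsupp sx vx) => z vz /(_ _ vz).
move=> s x t Ks sx Bx t01.
apply: (@seg_cvg _ _ _ _ s (s `|` finsupp y)%fset _ _ id (fun=> y)) => //= [z Bz sz|v|v].
- split; first exact: Kz.
    exact: fsubset_trans sz (fsubsetUl _ _).
  exact: fsubsetUr.
- exact: cvg_coords.
- exact: cvg_cst.
Qed.

(** * Full embeddings of complexes *)

Section RealizationMapTheory.
Context (R : realType) (V W : choiceType).
Context (E : simplicialComplex V) (D : simplicialComplex W) (i : simplicialMap E D).

Lemma realization_mapE (s : {fset V}) (x : realization R E) w :
  closed_simplex s x -> realization_map R i x w = \sum_(v <- s | i v == w) x v.
Proof.
move=> sx; rewrite /= pushforwardE big_mkcond [RHS]big_mkcond /=.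
apply: big_fset_incl => // v _; rewrite mem_finsupp negbK => /eqP ->.
by case: ifP.
Qed.

Lemma finsupp_realization_map (x : realization R E) :
  finsupp (realization_map R i x) = (i @` finsupp x)%fset.
Proof. exact: finsupp_pushforward. Qed.

Lemma continuous_realization_map : continuous (realization_map R i).
Proof.
apply: continuous_realization => s x Es sx.
have im y : closed_simplex s y -> closed_simplex (i @` s)%fset (realization_map R i y).
  move=> /fsubsetP sy; rewrite /closed_simplex /= finsupp_pushforward.
  by apply/fsubsetP => _ /imfsetP[v /= /sy vs ->]; rewrite in_imfset.
apply: (@cvg_realization _ _ _ _ _ _ _ (i @` s)%fset).
- exact: im.
- by apply: filterS (euclid_closed _ _) => y; exact: im.
move=> w _; rewrite (realization_mapE _ sx).
apply: cvg_trans (_ : (fun y : realization R E => \sum_(v <- s | i v == w) y v) @ euclid s x --> _).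
  apply: near_eq_cvg; apply: filterS (euclid_closed _ _) => y sy.
  by rewrite (realization_mapE _ sy).
by apply: cvg_sumr => v _ _; exact: cvg_coords.
Qed.

Context (i_inj : injective i).
Context (i_full : forall s, s != fset0 -> simplices D (i @` s)%fset -> simplices E s).

Lemma realization_map_coords (x : realization R E) v : realization_map R i x (i v) = x v.
Proof.
rewrite (realization_mapE _ (fsubset_refl _)).
under eq_bigl do rewrite (inj_eq i_inj).
have [vx|vx] := boolP (v \in finsupp x).
  rewrite big_mkcond (big_fsetD1 v) //= eqxx big_seq big1 ?addr0 // => u.
  by rewrite !inE => /andP[/negPf ->].
rewrite (coords_out (fsubset_refl _) vx) big_seq_cond big1 // => u /andP[ux /eqP uv].
by rewrite -uv ux in vx.
Qed.

Lemma realization_map_inj : injective (realization_map R i).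
Proof.
by move=> x y xy; apply: realization_eq => v; rewrite -!realization_map_coords xy.
Qed.

Lemma preimage_fset (s : {fset W}) : exists P : {fset V}, forall v, (v \in P) = (i v \in s).
Proof.
have fP : finite_set (i @^-1` [set` s]).
  by apply: finite_preimage => // u v _ _; exact: i_inj.
have /finite_fsetP[P PE] := fP; exists P => v.
by apply/idP/idP => [|h]; [have : [set` P] v -> [set` P] v by []; rewrite -{2}PE
  |have : [set` P] v by rewrite -PE].
Qed.

(** The vertices of E lying over the support of [y] span a simplex by fullness, and the coordinates
    of [y] can be pulled back to it. *)
Lemma realization_map_range (y : realization R D) :
  (forall w, w \in finsupp y -> range i w) -> range (realization_map R i) y.
Proof.
move=> yi; have [P PE] := preimage_fset (finsupp y).
have iP : (i @` P)%fset = finsupp y.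
  apply/fsetP => w; apply/imfsetP/idP => [[v /= vP ->]|wy]; first by rewrite -PE.
  by have [v _ vw] := yi w wy; exists v => //=; rewrite PE vw.
have yP v : v \in P -> 0 < y (i v) by rewrite PE coords_gt0.
have [v0 v0P] : exists v, v \in P.
  have [w wy] := finsupp_neq0 y; move: wy; rewrite -iP => /imfsetP[v /= vP _].
  by exists v.
have [|||x xE] := @point_exists R _ E P (fun v => y (i v)).
- by move=> v _; exact: coords_ge0.
- by exists v0 => //; exact: yP.
- rewrite (_ : [fset v in P | _]%fset = P); last first.
    by apply/fsetP => v; rewrite !inE /=; case: (boolP (v \in P)) => // /yP/gt_eqF ->.
  apply: i_full; first by apply/fset0Pn; exists v0.
  by rewrite iP; exact: coords_simplex.
exists x => //; apply: realization_eq => w.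
have S1 : \sum_(v <- P) y (i v) = 1.
  rewrite -(sum_coords (fsubset_refl (finsupp y))) -iP big_imfset //=.
  by move=> u v _ _; exact: i_inj.
have [[v _ <-]|nw] := pselect (range i w).
  rewrite realization_map_coords xE S1 divr1; case: ifPn => //.
  by rewrite PE mem_finsupp negbK => /eqP.
transitivity (0 : R).
  apply: (@coords_out _ _ _ (i @` finsupp x)%fset); first by rewrite /closed_simplex /= finsupp_pushforward.
  by apply/imfsetP => -[v _ wv]; apply: nw; exists v.
apply/esym/eqP; rewrite -[_ == _]negbK -mem_finsupp; apply/negP => wy.
exact: nw (yi w wy).
Qed.

Lemma realization_map_rangeP (y : realization R D) :
  range (realization_map R i) y <-> (forall w, w \in finsupp y -> range i w).
Proof.
split=> [[x _ <-] w|]; last exact: realization_map_range.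
by rewrite finsupp_realization_map => /imfsetP[v _ ->]; exists v.
Qed.

(** The realization of a full subcomplex is a topological embedding: its weak topology is induced
    from that of the larger complex. *)
Lemma embedding_cvg T (G : set_system T) (FG : Filter G) (F : T -> realization R E) z :
  (realization_map R i \o F) @ G --> realization_map R i z -> F @ G --> z.
Proof.
move=> Fz O; rewrite nbhsE => -[O1 [oO1 O1z] O1O]; apply: filterS O1O _.
(* The image of [O1] together with everything off the image of the embedding. That image is closed
   on simplices: off it, some coordinate at a vertex outside the range of [i] is positive. *)
pose O' := [set y : realization R D | forall x, realization_map R i x = y -> O1 x].
suff nO' : nbhs (realization_map R i z) O'.
  by have := Fz _ nO'; apply: (@filterS _ G) => t; exact.
apply: euclid_nbhs => [x /realization_map_inj -> //|s y Ds sy O'y].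
have [[z0 _ z0y]|nry] := pselect (range (realization_map R i) y); last first.
  have [w wy nw] : exists2 w, w \in finsupp y & ~ range i w.
    apply/not_exists2P => h; apply/nry/realization_map_rangeP => w wy.
    by apply: contrapT; case: (h w).
  apply: filterS (euclid_finsupp sy wy) => u wu x xu; exfalso; apply: nw.
  by have /realization_map_rangeP := imageP (realization_map R i) (I : setT x); apply; rewrite xu.
have [P PE] := preimage_fset s.
(* The inverse of the embedding, with junk value [z] off its image. It is continuous on each simplex
   because its coordinates are among those of its argument. *)
pose res (u : realization R D) := xget z [set x | realization_map R i x = u].
have resE x : res (realization_map R i x) = x.
  apply: realization_map_inj.
  by apply: (@xgetPex _ z [set x' | realization_map R i x' = _]); exists x.
have resP x : closed_simplex s (realization_map R i x) -> closed_simplex P x.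
  move=> /fsubsetP sx; apply/fsubsetP => v vx; rewrite PE; apply: sx.
  by rewrite finsupp_realization_map in_imfset.
have nr : \forall u \near within (range (realization_map R i)) (euclid s y),
    exists2 x, realization_map R i x = u & closed_simplex s u.
  rewrite /within /=; apply: filterS (euclid_closed _ _) => u su [x _ xu].
  by exists x.
have : res @ within (range (realization_map R i)) (euclid s y) --> z0.
  apply: (@cvg_realization _ _ _ _ _ _ _ P).
  - by apply: resP; rewrite z0y.
  - by apply: filterS nr => u [x <- /resP]; rewrite resE.
  - move=> v _; rewrite -realization_map_coords z0y.
    apply: cvg_trans (_ : (fun u : realization R D => u (i v)) @
        within (range (realization_map R i)) (euclid s y) --> _); last first.
      apply: cvg_within_filter; exact: cvg_coords.
    by apply: near_eq_cvg; apply: filterS nr => u [x <- _]; rewrite resE realization_map_coords.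
move=> /(_ O1); rewrite /within /= => h.
have := h (open_nbhs_nbhs (conj oO1 (O'y _ z0y))).
apply: (@filterS _ (euclid s y)) => u hu x xu; have := hu (ex_intro2 _ _ x I xu).
by rewrite /= -xu resE.
Qed.

(** The contraction is conjugated by the embedding; its inverse [res] is continuous on the image by
    [embedding_cvg]. *)
Lemma contracts_range : contractible R (realization R E) ->
  exists (c : realization R D * R -> realization R D) y, contracts (range (realization_map R i)) c y.
Proof.
move=> [x0 [H [cH H0 H1]]].
pose res (u : realization R D) := xget x0 [set x | realization_map R i x = u].
have resE x : res (realization_map R i x) = x.
  apply: realization_map_inj.
  by apply: (@xgetPex _ x0 [set x' | realization_map R i x' = _]); exists x.
exists (fun p => realization_map R i (H (res p.1, p.2))), (realization_map R i x0); split.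
- by exists x0.
- by move=> z t _ _; exists (H (res z, t)).
- by move=> _ [x _ <-] /=; rewrite resE H0.
- by move=> _ [x _ <-] /=; rewrite resE H1.
apply/subspace_continuousP => -[z t] /= [[x _ xz] t01].
apply: (continuous_cvg _ (@continuous_realization_map _)).
rewrite -xz resE.
have := (iffLR (subspace_continuousP _ _) cH) (x, t) t01; apply: cvg_comp.
set S := [set p | _].
have nS : \forall p \near within S (nbhs (realization_map R i x, t)), S p by exact: withinT.
have c1 : res \o fst @ within S (nbhs (realization_map R i x, t)) --> x.
  apply: embedding_cvg.
  apply: cvg_trans (_ : fst @ within S (nbhs (realization_map R i x, t)) --> _).
    by apply: near_eq_cvg; apply: filterS nS => -[u v] [/= [a _ <-] _]; rewrite resE.
  by apply: cvg_within_filter; exact: cvg_fst.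
have c2 : snd @ within S (nbhs (realization_map R i x, t)) --> t.
  by apply: cvg_within_filter; exact: cvg_snd.
move=> A nA; have nA' := cvg_pair c1 c2 nA.
suff : \forall p \near within S (nbhs (realization_map R i x, t)), A (res p.1, p.2) by [].
have {}nA' : \forall p \near within S (nbhs (realization_map R i x, t)),
    0 <= p.2 <= 1 -> A (res p.1, p.2) by exact: nA'.
by apply: filterS2 nS nA' => p [_ p01]; exact.
Qed.

End RealizationMapTheory.

(** * Concatenation and composition of homotopies *)

Lemma homotopic_trans (R : realType) (X Y : topologicalType) (f g h : X -> Y) :
  homotopic R f g -> homotopic R g h -> homotopic R f h.
Proof.
move=> [F [cF F0 F1]] [G [cG G0 G1]].
pose H (p : X * R) := if p.2 <= 2^-1 then F (p.1, 2 * p.2) else G (p.1, 2 * p.2 - 1).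
exists H; split; last 2 first.
- by move=> x; rewrite /H /= invr_ge0 ler0n mulr0 F0.
- move=> x; rewrite /H /= ifF; last by apply/negbTE; rewrite -ltNge; lra.
  by rewrite (_ : 2 * 1 - 1 = 1) ?G1 //; lra.
pose A := [set p : X * R | 0 <= p.2 <= 2^-1].
pose B := [set p : X * R | 2^-1 <= p.2 <= 1].
have -> : [set p : X * R | 0 <= p.2 <= 1] = A `|` B.
  apply/seteqP; split => -[x t] /=; rewrite /A /B /=.
    move=> /andP[t0 t1]; have [t2|/ltW t2] := leP t 2^-1.
      by left; rewrite t0.
    by right; rewrite t2.
  by case=> /andP[? ?]; apply/andP; split; lra.
have closed_strip (a b : R) : closed [set p : X * R | a <= p.2 <= b].
  have -> : [set p : X * R | a <= p.2 <= b] = snd @^-1` `[a, b]%classic.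
    by apply/seteqP; split => p /=; rewrite in_itv.
  by apply: closed_comp; [move=> p _; exact: cvg_snd|exact: interval_closed].
have aff (m q : R) (Z : set (X * R)) (p : X * R) :
    (fun p => (p.1, m * p.2 + q)) @ within Z (nbhs p) --> (p.1, m * p.2 + q).
  apply: cvg_within_filter.
  have c1 : fst @ nbhs p --> p.1 by case: p => p1 p2; exact: cvg_fst.
  have c2 : snd @ nbhs p --> p.2 by case: p {c1} => p1 p2; exact: cvg_snd.
  have c3 : (fun p : X * R => m * p.2 + q) @ nbhs p --> m * p.2 + q.
    by apply: cvgD; [apply: cvgM => //; exact: cvg_cst|exact: cvg_cst].
  exact: (cvg_pair c1 c3).
have pull (Z : set (X * R)) (m q : R) (Q h' : X * R -> Y) :
    {within [set p | 0 <= p.2 <= 1], continuous Q} ->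
    (forall p, Z p -> h' p = Q (p.1, m * p.2 + q)) ->
    (forall p, Z p -> 0 <= m * p.2 + q <= 1) -> {within Z, continuous h'}.
  move=> cQ HQ Z01; apply/subspace_continuousP => p Zp.
  have nZ : \forall u \near within Z (nbhs p), Z u by exact: withinT.
  apply: cvg_trans (_ : (fun p => Q (p.1, m * p.2 + q)) @ within Z (nbhs p) --> h' p).
    by apply: near_eq_cvg; apply: filterS nZ => u Zu; apply: esym; exact: HQ.
  rewrite HQ //.
  have := (iffLR (subspace_continuousP _ _) cQ) (p.1, m * p.2 + q) (Z01 _ Zp).
  apply: (@cvg_comp _ _ _ (fun p => (p.1, m * p.2 + q))).
  move=> O nO.
  have nO' : \forall u \near within Z (nbhs p),
      0 <= m * u.2 + q <= 1 -> O (u.1, m * u.2 + q) by exact: (aff m q Z p _ nO).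
  by apply: filterS2 nZ nO' => u Zu; apply; exact: Z01.
(* Gluing along two closed strips; at time 1/2 both formulas give [g]. *)
apply: withinU_continuous; [exact: closed_strip|exact: closed_strip| |].
- apply: (pull _ 2 0 F) => // -[x t] /andP[/= t0 t1].
    by rewrite /H /= t1 addr0.
  by apply/andP; split; lra.
- apply: (pull _ 2 (-1) G) => // -[x t] /andP[/= t0 t1]; last by apply/andP; split; lra.
  rewrite /H /=; case: ifPn => // t2; have -> : t = 2^-1 by lra.
  by rewrite (_ : 2 * 2^-1 = 1) ?subrr ?F1 ?G0 //; lra.
Qed.

Lemma homotopic_comp (R : realType) (X X' Y Y' : topologicalType) (a : X -> X')
    (b : Y -> Y') (f g : X' -> Y) :
  continuous a -> continuous b -> homotopic R f g ->
  homotopic R (b \o f \o a) (b \o g \o a).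
Proof.
move=> ca cb [H [cH H0 H1]]; exists (fun p => b (H (a p.1, p.2))).
split=> [|x /=|x /=]; rewrite ?H0 ?H1 //.
apply/subspace_continuousP => -[x t] /= t01.
apply: (continuous_cvg _ (@cb _)).
have := (iffLR (subspace_continuousP _ _) cH) (a x, t) t01.
apply: (@cvg_comp _ _ _ (fun p : X * R => (a p.1, p.2))).
have c1 : (fun p : X * R => a p.1) @ nbhs (x, t) --> a x.
  apply: (@cvg_comp _ _ _ fst a _ (nbhs x)); [exact: cvg_fst|exact: ca].
have c2 : snd @ nbhs (x, t) --> t by exact: cvg_snd.
move=> A nA; have nA' : \forall p \near nbhs (x, t), 0 <= p.2 <= 1 -> A (a p.1, p.2).
  exact: (cvg_pair c1 c2 nA).
by rewrite /within /=; apply: filterS nA' => p; exact.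
Qed.

Lemma fset_argmax (R : realType) (I : choiceType) (s : {fset I}) (f : I -> R) :
  s != fset0 -> exists2 i, i \in s & forall j, j \in s -> f j <= f i.
Proof.
elim/finSet_rect: s => s IH /fset0Pn[i is_].
have [s0|/IH] := eqVneq (s `\ i)%fset fset0.
  exists i => // j js; have : j \notin (s `\ i)%fset by rewrite s0 inE.
  by rewrite !inE js andbT negbK => /eqP ->.
move=> /(_ (fproperD1 is_))[k]; rewrite !inE => /andP[ki ks] kmax.
have [fik|/ltW fki] := leP (f i) (f k).
  exists k => // j js; have [->//|ji] := eqVneq j i.
  by apply: kmax; rewrite !inE ji.
exists i => // j js; have [->//|ji] := eqVneq j i.
by apply: le_trans (kmax j _) fki; rewrite !inE ji.
Qed.

(** * Barycentric subdivision *)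

Section Subdivision.
Context (R : realType) (V : choiceType) (L : simplicialComplex V).
Local Notation T := (face_poset L).
Local Notation D := (order_complex T).

Lemma face_neq0 (a : T) : sval a != fset0.
Proof. by have := valP a; rewrite inE; exact: simplex_neq0. Qed.

Lemma chain_max (c : {fset T}) : chains c ->
  exists2 m, m \in c & forall a, a \in c -> (sval a `<=` sval m)%fset.
Proof.
(* A face of largest cardinality contains every face comparable with it. *)
move=> [c0 cc]; have [m mc mmax] := fset_argmax (fun a : T => #|` sval a|%:R : R) c0.
exists m => // a ac; have /orP[//|ma] := cc _ _ ac mc.
have := mmax a ac; rewrite ler_nat => am.
have /eqP -> // : sval m == sval a by rewrite eqEfcard; apply/andP; split.
Qed.

Lemma chain_min (c : {fset T}) : chains c ->
  exists2 m, m \in c & forall a, a \in c -> (sval m `<=` sval a)%fset.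
Proof.
move=> [c0 cc]; have [m mc mmin] := fset_argmax (fun a : T => - #|` sval a|%:R : R) c0.
exists m => // a ac; have /orP[am|//] := cc _ _ ac mc.
have := mmin a ac; rewrite lerN2 ler_nat => ma.
have /eqP -> // : sval a == sval m by rewrite eqEfcard; apply/andP; split.
Qed.

(* The weight of the face a at y is positive exactly when a is the set of the
   vertices where y exceeds some nonnegative threshold. *)
Definition level_weight (y : realization R L) (a : T) : R :=
  Num.max 0 (\big[Num.min/1]_(v <- sval a) y v
             - \big[Num.max/0]_(v <- finsupp y | v \notin sval a) y v).

Lemma level_weight_gt0 y a : 0 < level_weight y a ->
  (forall v, v \in sval a -> 0 < y v) /\
  (forall u v, v \in sval a -> u \notin sval a -> y u < y v).
Proof.
rewrite /level_weight lt_max ltxx /= subr_gt0 => h.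
have m v : v \in sval a -> \big[Num.min/1]_(v <- sval a) y v <= y v.
  by move=> va; exact: ge_bigmin_seq.
split=> [v /m|u v /m va ua].
  by apply: lt_le_trans; apply: le_lt_trans h; exact: bigmax_ge_id.
apply: lt_le_trans va; apply: le_lt_trans h.
have [uy|uy] := boolP (u \in finsupp y); first exact: le_bigmax_seq.
by rewrite (coords_out (fsubset_refl _) uy); exact: bigmax_ge_id.
Qed.

Lemma level_weight_ge0 y a : 0 <= level_weight y a.
Proof. by rewrite le_max lexx. Qed.

(** With the varying support replaced by a fixed [s], the weight is one continuous formula in the
    coordinates on all of |s|. *)
Lemma level_weightE s (y : realization R L) a : closed_simplex s y ->
  level_weight y a = Num.max 0 (\big[Num.min/1]_(v <- sval a) y v
             - \big[Num.max/0]_(v <- s | v \notin sval a) y v).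
Proof.
move=> /fsubsetP sy; congr (Num.max 0 (_ - _)); apply/le_anti/andP; split.
  exact: sub_bigmax_seq.
rewrite big_seq_cond; apply: bigmax_le; first exact: bigmax_ge_id.
move=> v /andP[vs va]; have [vy|vy] := boolP (v \in finsupp y); first exact: le_bigmax_seq.
by rewrite (coords_out (fsubset_refl _) vy); exact: bigmax_ge_id.
Qed.

Lemma level_weight_cvg s (y : realization R L) a : closed_simplex s y ->
  level_weight^~ a @ euclid s y --> level_weight y a.
Proof.
move=> sy; rewrite (level_weightE _ sy).
apply: cvg_trans (_ : (fun z : realization R L =>
    Num.max 0 (\big[Num.min/1]_(v <- sval a) z v
             - \big[Num.max/0]_(v <- s | v \notin sval a) z v)) @ euclid s y --> _).
  apply: near_eq_cvg; apply: filterS (euclid_closed _ _) => z sz.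
  by rewrite (level_weightE _ sz).
apply: cvg_maxr; first exact: cvg_cst.
apply: cvgB.
- apply: cvg_big => [[u v]|v _]; last exact: cvg_coords.
  by apply: cvg_minr; [exact: cvg_fst|exact: cvg_snd].
- apply: cvg_big => [[u v]|v _]; last exact: cvg_coords.
  by apply: cvg_maxr; [exact: cvg_fst|exact: cvg_snd].
Qed.

(** The witness is the face of the vertices at which [y] attains its maximum. *)
Lemma level_weight_exists y : exists2 a, 0 < level_weight y a & (sval a `<=` finsupp y)%fset.
Proof.
have y0 : finsupp y != fset0 by exact: simplex_neq0 (coords_simplex y).
have [m my mmax] := fset_argmax y y0.
pose s := [fset v in finsupp y | y m <= y v]%fset.
have sy : (s `<=` finsupp y)%fset by apply/fsubsetP => v; rewrite !inE => /andP[].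
have Ls : s \in simplices L.
  rewrite inE; apply: simplex_face (coords_simplex y) sy _.
  by apply/fset0Pn; exists m; rewrite !inE my /=.
exists (exist _ s Ls) => //=; rewrite /level_weight lt_max ltxx /= subr_gt0.
apply: (@lt_le_trans _ _ (y m)).
  rewrite big_seq_cond; apply: bigmax_lt; first by rewrite coords_gt0.
  by move=> v /andP[vy]; rewrite !inE vy /= -ltNge.
(* The default value 1 of the minimum is harmless because no coordinate exceeds 1. *)
rewrite big_seq; apply: le_bigmin; first exact: coords_le1.
by move=> v; rewrite !inE => /andP[].
Qed.

Lemma faces_exist (s : {fset V}) : exists P : {fset T}, forall a, (a \in P) = (sval a `<=` s)%fset.
Proof.
have fP : finite_set ((fun a : T => sval a) @^-1` [set` fpowerset s]).
  by apply: finite_preimage => // a b _ _ ab; exact: val_inj.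
have /finite_fsetP[P PE] := fP; exists P => a; rewrite -fpowersetE.
by apply/idP/idP => [|h]; [have : [set` P] a -> [set` P] a by []; rewrite -{2}PE
  |have : [set` P] a by rewrite -PE].
Qed.

(** Coordinates of the affine map to ||L|| that sends each vertex of the order complex, a face of L,
    to its barycenter. *)
Definition bary_weight (x : realization R D) (v : V) : R :=
  \sum_(a <- finsupp x | v \in sval a) x a / #|` sval a|%:R.

Lemma bary_weightE (s : {fset T}) x v : closed_simplex s x ->
  bary_weight x v = \sum_(a <- s | v \in sval a) x a / #|` sval a|%:R.
Proof.
move=> sx; rewrite /bary_weight big_mkcond [RHS]big_mkcond /=.
apply: big_fset_incl => // a _; rewrite mem_finsupp negbK => /eqP ->.
by rewrite mul0r; case: ifP.
Qed.

Lemma bary_weight_ge0 x v : 0 <= bary_weight x v.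
Proof. by rewrite sumr_ge0 // => a _; rewrite divr_ge0 ?coords_ge0. Qed.

Lemma barycenter_exists : exists f : realization R D -> realization R L,
  forall x v, f x v = bary_weight x v.
Proof.
suff H x : exists y : realization R L, forall v, y v = bary_weight x v.
  by have [f fE] := choice H; exists f.
have [m mx mmax] := chain_max (coords_simplex x).
have out v : v \notin sval m -> bary_weight x v = 0.
  move=> vm; rewrite /bary_weight big_seq_cond big1 // => a /andP[/mmax/fsubsetP am /am].
  by rewrite (negPf vm).
have pos v : v \in sval m -> 0 < bary_weight x v.
  move=> vm; rewrite /bary_weight big_mkcond (big_fsetD1 m) //= vm ltr_wpDr //.
    by rewrite sumr_ge0 // => a _; case: ifP => // _; rewrite divr_ge0 ?coords_ge0.
  by rewrite divr_gt0 ?coords_gt0 // ltr0n cardfs_gt0 face_neq0.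
have [v0 v0m] := fset0Pn _ (face_neq0 m).
(* After exchanging the sums, each face [a] of the chain contributes [x a], split equally among its
   vertices, all of which lie in the largest face [m]. *)
have S1 : \sum_(v <- sval m) bary_weight x v = 1.
  under eq_bigr do rewrite /bary_weight big_mkcond.
  rewrite exchange_big /= -[RHS](coords_sum1 x) big_seq [RHS]big_seq.
  apply: eq_bigr => a ax; rewrite -big_mkcond /= -big_filter big_const_seq count_predT iter_addr_0.
  have -> : size [seq v <- sval m | v \in sval a] = #|` sval a|.
    apply/perm_size/uniq_perm.
    - exact/filter_uniq/fset_uniq.
    - exact: fset_uniq.
    - move=> v; rewrite mem_filter; case: (boolP (v \in sval a)) => //= va.
      exact: (fsubsetP (mmax a ax)).
  by rewrite -[LHS]mulr_natr divfK // pnatr_eq0 cardfs_eq0 face_neq0.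
have [|||y yE] := @point_exists R _ L (sval m) (bary_weight x).
- by move=> v _; exact: bary_weight_ge0.
- by exists v0 => //; exact: pos.
- rewrite (_ : [fset v in sval m | _]%fset = sval m).
    by have := valP m; rewrite inE.
  by apply/fsetP => v; rewrite !inE /=; case: (boolP (v \in sval m)) => // /pos/gt_eqF ->.
by exists y => v; rewrite yE S1 divr1; case: ifPn => // /out.
Qed.

(* Some vertex v of a avoids every member of the chain supporting x that does not
   contain a, so y is at least as large at the vertices of the least member
   containing a as it is at v. *)
Lemma level_weight_barycenter (x : realization R D) (y : realization R L) a :
  (forall v, y v = bary_weight x v) -> 0 < level_weight y a -> a \in finsupp x.
Proof.
move=> yE /level_weight_gt0[ypos ylt]; apply/negPn/negP => ax.
have [c0 cc] := coords_simplex x.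
have [v va vc] : exists2 v, v \in sval a &
    forall b, b \in finsupp x -> v \in sval b -> (sval a `<=` sval b)%fset.
  pose c := [fset b in finsupp x | ~~ (sval a `<=` sval b)%fset]%fset.
  have [c_0|cn0] := eqVneq c fset0.
    have [v va] := fset0Pn _ (face_neq0 a); exists v => // b bx _.
    by have : b \notin c by [rewrite c_0 inE]; rewrite !inE bx /= negbK.
  have cC : chains c.
    by split=> // b b'; rewrite !inE => /andP[bx _] /andP[b'x _]; exact: cc.
  have [m mc mmax] := chain_max cC.
  move: (mc); rewrite !inE => /andP[mx /fsubsetPn[v va vm]].
  exists v => // b bx vb; apply/negPn/negP => ab.
  have /fsubsetP bm : (sval b `<=` sval m)%fset by apply: mmax; rewrite !inE bx.
  by rewrite bm in vm.
pose c := [fset b in finsupp x | (sval a `<=` sval b)%fset]%fset.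
have cn0 : c != fset0.
  apply/eqP => c_0; have := ypos v va; rewrite yE /bary_weight big_seq_cond big1 ?ltxx // => b /andP[bx vb].
  by have : b \notin c by [rewrite c_0 inE]; rewrite !inE bx /= (vc b bx vb).
have cC : chains c.
  by split=> // b b'; rewrite !inE => /andP[bx _] /andP[b'x _]; exact: cc.
have [m mc mmin] := chain_min cC.
move: (mc); rewrite !inE => /andP[mx am].
have [u um ua] : exists2 u, u \in sval m & u \notin sval a.
  apply/fsubsetPn/negP => ma; move/negP: ax; apply.
  by have -> : a = m; [apply/val_inj/eqP; rewrite eqEfsubset am|].
have := ylt u v va ua; rewrite ltNge => /negP; apply.
rewrite !yE /bary_weight big_mkcond [leRHS]big_mkcond /= big_seq [leRHS]big_seq.
apply: ler_sum => b bx; case: ifPn => vb; last first.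
  by case: ifP => // _; rewrite divr_ge0 ?coords_ge0.
have bc : b \in c by rewrite !inE bx /=; exact: vc.
by rewrite (fsubsetP (mmin b bc) u um).
Qed.

Lemma continuous_barycenter (f : realization R D -> realization R L) :
  (forall x v, f x v = bary_weight x v) -> continuous f.
Proof.
move=> fE; apply: continuous_realization => s x Ds sx.
have [m ms mmax] := chain_max Ds.
have sub y : closed_simplex s y -> closed_simplex (sval m) (f y).
  move=> sy; apply/fsubsetP => v; rewrite mem_finsupp fE; apply: contraR => vm.
  rewrite (bary_weightE _ sy) big_seq_cond big1 // => a /andP[/mmax/fsubsetP am /am].
  by rewrite (negPf vm).
apply: (@cvg_realization _ _ _ _ _ _ _ (sval m)).
- exact: sub.
- by apply: filterS (euclid_closed _ _) => y; exact: sub.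
move=> v _; rewrite fE (bary_weightE _ sx).
apply: cvg_trans (_ : (fun y : realization R D =>
    \sum_(a <- s | v \in sval a) y a / #|` sval a|%:R) @ euclid s x --> _).
  apply: near_eq_cvg; apply: filterS (euclid_closed _ _) => y sy.
  by rewrite fE (bary_weightE _ sy).
by apply: cvg_sumr => a _ _; apply: cvgM; [exact: cvg_coords|exact: cvg_cst].
Qed.

(** The map normalizes the level weights. Faces of positive weight are superlevel sets of [y], hence
    nested, so they form a chain. *)
Lemma level_map_exists : exists g : realization R L -> realization R D,
  continuous g /\ forall y a, a \in finsupp (g y) -> 0 < level_weight y a.
Proof.
have [faces facesE] := choice faces_exist.
have low (y : realization R L) a : a \notin faces (finsupp y) -> level_weight y a = 0.
  rewrite facesE => /fsubsetPn[v va vy]; apply/eqP; rewrite eq_le level_weight_ge0 andbT leNgt.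
  by apply/negP => /level_weight_gt0[/(_ v va)]; rewrite coords_gt0 (negPf vy).
pose mass s (y : realization R L) := \sum_(a <- faces s) level_weight y a.
have massE s (y : realization R L) : closed_simplex s y -> mass (finsupp y) y = mass s y.
  move=> sy; apply: big_fset_incl => [|a _]; last exact: low.
  by apply/fsubsetP => a; rewrite !facesE => ay; exact: fsubset_trans ay sy.
have mass_gt0 s (y : realization R L) : closed_simplex s y -> 0 < mass s y.
  move=> sy; rewrite -(massE _ _ sy) /mass.
  have [a wa ay] := level_weight_exists y; rewrite (big_fsetD1 a) /= ?facesE //.
  by rewrite ltr_wpDr // sumr_ge0 // => b _; exact: level_weight_ge0.
have H (y : realization R L) : exists x : realization R D,
    forall a, x a = level_weight y a / mass (finsupp y) y.
  have [|||x xE] := @point_exists R _ D (faces (finsupp y)) (level_weight y).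
  - by move=> a _; exact: level_weight_ge0.
  - by have [a wa ay] := level_weight_exists y; exists a => //; rewrite facesE.
  - split.
      have [a wa ay] := level_weight_exists y.
      by apply/fset0Pn; exists a; rewrite !inE facesE ay /= gt_eqF.
    have gt0 a : level_weight y a != 0 -> 0 < level_weight y a.
      by rewrite lt_def level_weight_ge0 andbT.
    move=> a b; rewrite !inE => /andP[_ /gt0/level_weight_gt0[_ alt]].
    move=> /andP[_ /gt0/level_weight_gt0[_ blt]].
    (* If neither face contained the other, a vertex of each outside the other would have the
       strictly larger coordinate. *)
    have [ab|/fsubsetPn[v va vb]] := boolP (sval a `<=` sval b)%fset.
      by apply/orP; left.
    apply/orP; right; apply/fsubsetP => u ub; apply/negPn/negP => ua.
    by have := lt_trans (alt u v va ua) (blt v u ub vb); rewrite ltxx.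
  exists x => a; rewrite xE; case: ifPn => // /low ->.
  by [].
have [g gE] := choice H; exists g; split; last first.
  move=> y a; rewrite mem_finsupp gE mulf_eq0 negb_or => /andP[w0 _].
  by rewrite lt_def w0 level_weight_ge0.
apply: continuous_realization => s y Ls sy.
have sub z : closed_simplex s z -> closed_simplex (faces s) (g z).
  move=> sz; apply/fsubsetP => a; rewrite mem_finsupp gE mulf_eq0 negb_or => /andP[w0 _].
  have : a \in faces (finsupp z) by apply: contraR w0 => /low ->.
  by rewrite !facesE => az; exact: fsubset_trans az sz.
apply: (@cvg_realization _ _ _ _ _ _ _ (faces s)).
- exact: sub.
- by apply: filterS (euclid_closed _ _) => z; exact: sub.
move=> a _; rewrite gE (massE _ _ sy).
apply: cvg_trans (_ : (fun z => level_weight z a / mass s z) @ euclid s y --> _).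
  apply: near_eq_cvg; apply: filterS (euclid_closed _ _) => z sz.
  by rewrite gE (massE _ _ sz).
apply: cvgM; first exact: level_weight_cvg.
apply: cvgV; first by rewrite gt_eqF ?mass_gt0.
by apply: cvg_sumr => b _ _; exact: level_weight_cvg.
Qed.

(** The composite of the barycenter map [f] with the level map [g] does not enlarge supports, so it
    is homotopic to the identity; contracting ||L|| between [f] and [g] makes it constant. *)
Lemma subdivision_contractible :
  contractible R (realization R L) -> contractible R (realization R D).
Proof.
move=> [y0 y0P]; have [f fE] := barycenter_exists.
have [g [cg gP]] := level_map_exists; exists (g y0).
have cf := continuous_barycenter fE.
have gf x : (finsupp (g (f x)) `<=` finsupp x)%fset.
  by apply/fsubsetP => a /gP; exact: level_weight_barycenter.
have [_ h] := homotopic_shrink (fun x => continuous_comp (cf x) (cg (f x))) gf.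
exact: homotopic_trans h (homotopic_comp cf cg y0P).
Qed.

End Subdivision.

(** * Iterated contractions *)

Section Fold.
Context (R : realType) (T : choiceType) (le : rel T).
Context (le_anti : antisymmetric le).
Context (le_trans : transitive le).
Context (Y : topologicalType) (y0 : Y).
Context (C : T -> set Y) (c : T -> Y * R -> Y) (y : T -> Y).
Context (C_mono : forall u v, le u v -> C u `<=` C v).
Context (cC : forall v, contracts (C v) (c v) (y v)).

(** The accumulator holds the point reached and the mass consumed. Zero weights are skipped, and at
    mass 0 a positive weight selects [y v], so the initial point [y0] is discarded. *)
Definition fold_step (w : T -> R) (acc : Y * R) (v : T) : Y * R :=
  if w v == 0 then acc
  else (if acc.2 <= w v then y v else c v (acc.1, w v / acc.2), acc.2 + w v).

(* Iterated contraction: a list v_1 <= ... <= v_n with weights w is sent to the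
   point obtained by contracting in C v_k, towards y v_k, the point reached so
   far; the contraction is over once v_k outweighs its predecessors, which makes
   the result continuous where the weight of these predecessors vanishes. *)
Definition fold_contract (w : T -> R) (l : seq T) := foldl (fold_step w) (y0, 0) l.

Lemma fold_rcons w l v :
  fold_contract w (rcons l v) = fold_step w (fold_contract w l) v.
Proof. by rewrite /fold_contract foldl_rcons. Qed.

Lemma sum_rcons (w : T -> R) l v : \sum_(u <- rcons l v) w u = \sum_(u <- l) w u + w v.
Proof. by rewrite -cats1 big_cat big_seq1. Qed.

Lemma fold_mass w l : (fold_contract w l).2 = \sum_(v <- l) w v.
Proof.
elim/last_ind: l => [|l v IH]; first by rewrite big_nil.
rewrite fold_rcons /fold_step sum_rcons -IH.
by case: eqP => [->|_] /=; rewrite ?addr0.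
Qed.

Lemma fold_filter w l :
  fold_contract w [seq v <- l | w v != 0] = fold_contract w l.
Proof.
elim/last_ind: l => [//|l v IH]; rewrite filter_rcons fold_rcons /fold_step.
by case: eqP => /= wv; rewrite ?fold_rcons ?IH // /fold_step; case: eqP.
Qed.

(** Membership in [C u] is carried along in the induction so that the next contraction always starts
    inside its own domain; [Z] is any further invariant preserved by the contractions. *)
Lemma fold_carrier (Z : set Y) (w : T -> R) (l : seq T) :
  pairwise le l -> (forall v, v \in l -> 0 <= w v) ->
  (forall v, v \in l -> w v != 0 -> Z (y v)) ->
  (forall v z t, v \in l -> w v != 0 -> 0 <= t <= 1 -> C v z -> Z z -> Z (c v (z, t))) ->
  0 < \sum_(v <- l) w v ->
  Z (fold_contract w l).1 /\
  forall u, (forall v, v \in l -> le v u) -> C u (fold_contract w l).1.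
Proof.
elim/last_ind: l => [|l v IH]; first by rewrite big_nil ltxx.
rewrite pairwise_rcons => /andP[/allP lv ll] w0 Zy Zc.
have lsub u : u \in l -> u \in rcons l v by move=> ul; rewrite mem_rcons inE ul orbT.
have vl : v \in rcons l v by rewrite mem_rcons mem_head.
have {}IH : 0 < \sum_(u <- l) w u -> Z (fold_contract w l).1 /\
    forall u, (forall v, v \in l -> le v u) -> C u (fold_contract w l).1.
  apply: IH => // [u ul|u ul|u z t ul]; [exact/w0/lsub|exact/Zy/lsub|exact/Zc/lsub].
rewrite fold_rcons /fold_step fold_mass.
rewrite sum_rcons.
have m0 : 0 <= \sum_(u <- l) w u by rewrite big_seq sumr_ge0 // => u ul; exact/w0/lsub.
case: eqP => [->|/eqP wv] /=.
  rewrite addr0 => /IH[Zf Cf]; split=> // u lu; apply: Cf => x xl; exact/lu/lsub.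
move=> _; have wv0 : 0 < w v by rewrite lt_def wv w0.
have [Cy Cc _ _ _] := cC v.
case: leP => [mw|wm].
  by split; [exact: Zy|move=> u /(_ v vl) /C_mono; exact].
have mpos := lt_trans wv0 wm.
have [Zf Cf] := IH mpos; have Cvf := Cf v lv.
have t01 : 0 <= w v / \sum_(u <- l) w u <= 1.
  by rewrite divr_ge0 ?(ltW wv0) //= ler_pdivrMr // mul1r ltW.
by split; [exact: Zc|move=> u /(_ v vl) /C_mono; apply; exact: Cc].
Qed.

Lemma fold_cvg S (G : set_system S) (FG : Filter G) (w : S -> T -> R) (w1 : T -> R)
    (l : seq T) : pairwise le l ->
  (\forall s \near G, forall v, 0 <= w s v) -> (forall v, 0 <= w1 v) ->
  (forall v, v \in l -> w^~ v @ G --> w1 v) ->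
  0 < \sum_(v <- l) w1 v ->
  (fun s => (fold_contract (w s) l).1) @ G --> (fold_contract w1 l).1.
Proof.
move=> + nw w10; elim/last_ind: l => [|l v IH]; first by rewrite big_nil ltxx.
rewrite pairwise_rcons => /andP[/allP lv ll] cw.
have lsub u : u \in l -> u \in rcons l v by move=> ul; rewrite mem_rcons inE ul orbT.
have cv : w^~ v @ G --> w1 v by apply: cw; rewrite mem_rcons mem_head.
have {}IH : 0 < \sum_(u <- l) w1 u ->
    (fun s => (fold_contract (w s) l).1) @ G --> (fold_contract w1 l).1.
  by apply: IH => // u ul; exact/cw/lsub.
have cm : (fun s => \sum_(u <- l) w s u) @ G --> \sum_(u <- l) w1 u.
  by apply: cvg_sumr => u ul _; exact/cw/lsub.
rewrite sum_rcons.
(* When the last weight strictly exceeds the mass before it, the result is locally constant. This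
   covers the case where that mass vanishes and the earlier point need not converge. *)
move=> mpos; have [mw|wm] := ltP (\sum_(u <- l) w1 u) (w1 v).
  have -> : (fold_contract w1 (rcons l v)).1 = y v.
    rewrite fold_rcons /fold_step fold_mass ifN /= ?(ltW mw) // gt_eqF //.
    by apply: le_lt_trans mw; rewrite sumr_ge0.
  apply: cvg_trans (_ : (fun=> y v) @ G --> y v); last exact: cvg_cst.
  have : \forall s \near G, 0 < w s v - \sum_(u <- l) w s u.
    by apply: (cvgr_gt _ (cvgB cv cm)); rewrite subr_gt0.
  move=> nlt; apply: near_eq_cvg; apply: filterS2 nw nlt => s ws0; rewrite subr_gt0 => slt.
  rewrite fold_rcons /fold_step fold_mass ifN /= ?(ltW slt) // gt_eqF //.
  by apply: le_lt_trans slt; rewrite sumr_ge0.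
have m0 : 0 < \sum_(u <- l) w1 u.
  by move: mpos (w10 v) wm; set m := \sum_(u <- l) _; lra.
have [Cy Cc c0 c1 cc] := cC v.
(* For positive earlier mass, the branches of [fold_step] merge into one formula: [c v] is the
   identity at time 0 and constant at time 1. *)
have val (w' : T -> R) : (forall v, 0 <= w' v) -> 0 < \sum_(u <- l) w' u ->
    C v (fold_contract w' l).1 /\
    (fold_contract w' (rcons l v)).1 =
      c v ((fold_contract w' l).1, Num.min 1 (w' v / \sum_(u <- l) w' u)).
  move=> w'0 m'0; have [//|//|//|//|//|_ Cf] := @fold_carrier setT w' l.
  have Cv := Cf v lv; split => //; rewrite fold_rcons /fold_step fold_mass.
  case: eqP => [->|_]; first by rewrite mul0r min_r // c0.
  rewrite /=; case: leP => [mw|mw].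
    by rewrite min_l ?c1 // ler_pdivlMr // mul1r.
  by rewrite min_r // ler_pdivrMr // mul1r ltW.
have [C1 ->] := val w1 w10 m0.
have nm : \forall s \near G, 0 < \sum_(u <- l) w s u by exact: (cvgr_gt _ cm).
apply: cvg_trans (_ : (fun s => c v ((fold_contract (w s) l).1,
    Num.min 1 (w s v / \sum_(u <- l) w s u))) @ G --> _).
  by apply: near_eq_cvg; apply: filterS2 nw nm => s ws0 ms; have [_ ->] := val (w s) ws0 ms.
have ct : (fun s => Num.min 1 (w s v / \sum_(u <- l) w s u)) @ G -->
    Num.min 1 (w1 v / \sum_(u <- l) w1 u).
  apply: cvg_minr; [exact: cvg_cst|apply: cvgM => //].
  by apply: cvgV => //; rewrite gt_eqF.
have min01 (a b : R) : 0 <= a -> 0 < b -> 0 <= Num.min 1 (a / b) <= 1.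
  by move=> a0 b0; rewrite le_min ler01 divr_ge0 ?(ltW b0) // ge_min lexx.
have := (iffLR (subspace_continuousP _ _) cc)
  ((fold_contract w1 l).1, Num.min 1 (w1 v / \sum_(u <- l) w1 u)) (conj C1 (min01 _ _ (w10 v) m0)).
apply: (@cvg_comp _ _ _ (fun s => ((fold_contract (w s) l).1,
    Num.min 1 (w s v / \sum_(u <- l) w s u)))).
move=> O nO; have nO' : \forall s \near G, C v (fold_contract (w s) l).1 /\
    0 <= Num.min 1 (w s v / \sum_(u <- l) w s u) <= 1 ->
    O ((fold_contract (w s) l).1, Num.min 1 (w s v / \sum_(u <- l) w s u)).
  exact: (cvg_pair (IH m0) ct nO).
apply: filterS3 nw nm nO' => s ws0 ms; apply; split; last exact: min01.
by have [] := val (w s) ws0 ms.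
Qed.

Context (K : simplicialComplex T).
Context (K_chain : forall s, simplices K s -> {in s &, total le}).

Definition contract_map (x : realization R K) : Y :=
  (fold_contract x (sort le (finsupp x))).1.

Lemma pairwise_sort_simplex s : simplices K s -> pairwise le (sort le s).
Proof.
move=> Ks; rewrite -sorted_pairwise //; apply: (sort_sorted_in (K_chain Ks)).
exact/allP.
Qed.

(** Compatibility with faces: vertices of weight zero do not affect the fold, and the sorted support
    is the sorted [s] with these removed. *)
Lemma contract_mapE s (x : realization R K) : simplices K s -> closed_simplex s x ->
  contract_map x = (fold_contract x (sort le s)).1.
Proof.
move=> Ks /fsubsetP sx; rewrite /contract_map -[in RHS]fold_filter; congr (fold_contract x _).1.
apply: (@sorted_eq _ le) => //.
- by rewrite sorted_pairwise // pairwise_sort_simplex //; exact: coords_simplex.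
- by apply: sorted_filter => //; rewrite sorted_pairwise // pairwise_sort_simplex.
apply: uniq_perm; rewrite ?filter_uniq ?sort_uniq ?fset_uniq // => v.
rewrite mem_filter !mem_sort -mem_finsupp; case: (boolP (v \in finsupp x)) => //= /sx.
by move=> ->.
Qed.

Lemma sum_sort_coords s (x : realization R K) : closed_simplex s x ->
  \sum_(v <- sort le s) x v = 1.
Proof. by move=> sx; rewrite (perm_big _ (permEl (perm_sort _ _))) sum_coords. Qed.

Lemma continuous_contract_map : continuous contract_map.
Proof.
apply: continuous_realization => s x Ks sx; rewrite (contract_mapE Ks sx).
apply: cvg_trans (_ : (fun z : realization R K => (fold_contract z (sort le s)).1) @ euclid s x --> _).
  apply: near_eq_cvg; apply: filterS (euclid_closed _ _) => z sz.
  by rewrite (contract_mapE Ks sz).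
apply: fold_cvg.
- exact: pairwise_sort_simplex.
- by near=> z => v; exact: coords_ge0.
- by move=> v; exact: coords_ge0.
- by move=> v _; exact: cvg_coords.
- by rewrite sum_sort_coords.
Unshelve. all: by end_near.
Qed.

Lemma contract_map_carrier (Z : set Y) (x : realization R K) :
  (forall v, v \in finsupp x -> Z (y v)) ->
  (forall v z t, v \in finsupp x -> 0 <= t <= 1 -> C v z -> Z z -> Z (c v (z, t))) ->
  Z (contract_map x).
Proof.
move=> Zy Zc; apply: (fold_carrier _ _ _ _ _).1.
- exact: pairwise_sort_simplex (coords_simplex x).
- by move=> v _; exact: coords_ge0.
- by move=> v; rewrite mem_sort => vx _; exact: Zy.
- by move=> v z t; rewrite mem_sort => vx _; exact: Zc.
- by rewrite sum_sort_coords //; exact: fsubset_refl.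
Qed.

End Fold.

(** * Deformation onto a full subcomplex *)

Section ChainComplex.
Context (T : choiceType) (le : rel T).

(** Chains of a bare relation: the argument is run both for the order of the join and for its
    reverse. *)
Definition le_chains : set {fset T} := [set s | s != fset0 /\ {in s &, total le}].

Lemma le_chains_neq0 s : le_chains s -> s != fset0.
Proof. by case. Qed.

Lemma le_chains_face (s t : {fset T}) :
  le_chains s -> (t `<=` s)%fset -> t != fset0 -> le_chains t.
Proof.
move=> [_ sP] /fsubsetP ts t0; split=> // x y xt yt.
by apply: sP; exact: ts.
Qed.

Definition chain_complex := SimplicialComplex le_chains_neq0 le_chains_face.

Definition cylinder_le : rel (T * bool) :=
  fun p q => le p.1 q.1 && (p.2 ==> q.2).

End ChainComplex.

Section Deformation.
Context (R : realType) (T : choiceType) (le : rel T).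
Context (leT_refl : reflexive le).
Context (leT_anti : antisymmetric le).
Context (leT_trans : transitive le).
Context (D : simplicialComplex T).
Context (D_chain : forall s, simplices D s <-> s != fset0 /\ {in s &, total le}).
Local Notation Cyl := (chain_complex (cylinder_le le)).

(** The intervals from [mass_lt x v] to [mass_le x v], for [v] in the support, have lengths [x v]
    and tile [0, 1] in the order of the chain. *)
Definition mass_le (x : realization R D) v := \sum_(u <- finsupp x | le u v) x u.
Definition mass_lt (x : realization R D) v :=
  \sum_(u <- finsupp x | le u v && (u != v)) x u.

Lemma mass_cvg (P : T -> pred T) s (x : realization R D) v : closed_simplex s x ->
  (fun z : realization R D => \sum_(u <- finsupp z | P v u) z u) @ euclid s x -->
  \sum_(u <- finsupp x | P v u) x u.
Proof.
have E (z : realization R D) : closed_simplex s z ->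
    \sum_(u <- finsupp z | P v u) z u = \sum_(u <- s | P v u) z u.
  move=> sz; rewrite big_mkcond [RHS]big_mkcond; apply: big_fset_incl => //= u _.
  by rewrite mem_finsupp negbK => /eqP ->; case: ifP.
move=> sx; rewrite (E _ sx).
apply: cvg_trans (_ : (fun z : realization R D => \sum_(u <- s | P v u) z u) @ euclid s x --> _).
  by apply: near_eq_cvg; apply: filterS (euclid_closed _ _) => z sz; rewrite E.
by apply: cvg_sumr => u _ _; exact: cvg_coords.
Qed.

Lemma mass_lt_ge0 x v : 0 <= mass_lt x v.
Proof. by rewrite sumr_ge0 // => u _; exact: coords_ge0. Qed.

Lemma mass_le_le1 x v : mass_le x v <= 1.
Proof.
rewrite -(coords_sum1 x) /mass_le big_mkcond /=; apply: ler_sum => u _.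
by case: ifP => // _; exact: coords_ge0.
Qed.

Lemma mass_le_lt (x : realization R D) v : v \in finsupp x ->
  mass_le x v = x v + mass_lt x v.
Proof.
move=> vx; rewrite /mass_le /mass_lt [in LHS]big_mkcond [in RHS]big_mkcond /=.
rewrite (big_fsetD1 v) //= leT_refl; congr (_ + _).
rewrite [RHS](big_fsetD1 v) //= eqxx andbF add0r big_seq [RHS]big_seq.
by apply: eq_bigr => u; rewrite !inE => /andP[-> _]; rewrite andbT.
Qed.

Lemma mass_mono x u v : le u v -> u != v -> mass_le x u <= mass_lt x v.
Proof.
move=> uv nuv; rewrite /mass_le /mass_lt [leLHS]big_mkcond [leRHS]big_mkcond /=.
apply: ler_sum => t _; case: ifP => tu; last by case: ifP => // _; exact: coords_ge0.
rewrite (leT_trans tu uv) /= ifT //; apply: contraNneq nuv => tv; subst t.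
by apply/eqP/leT_anti; rewrite uv.
Qed.

(* At time t, the vertices on level false start below the mass 1 - t and those
   on level true end above it, so the former are below the latter. *)
Definition prism_weight (p : realization R D * R) (q : T * bool) : R :=
  p.1 q.1 * Num.max 0 (if q.2 then mass_le p.1 q.1 - (1 - p.2)
                       else 1 - p.2 - mass_lt p.1 q.1).

Lemma prism_weight_ge0 p q : 0 <= prism_weight p q.
Proof. by rewrite mulr_ge0 ?coords_ge0 // le_max lexx. Qed.

Lemma prism_weight_gt0 p q : (0 < prism_weight p q) =
  (q.1 \in finsupp p.1) && (0 < if q.2 then mass_le p.1 q.1 - (1 - p.2)
                       else 1 - p.2 - mass_lt p.1 q.1).
Proof.
rewrite /prism_weight -coords_gt0; set m := (if _ then _ else _).
have [x0|x0] := ltP 0 (p.1 q.1); first by rewrite pmulr_rgt0 // lt_max ltxx.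
have -> : p.1 q.1 = 0 by apply/le_anti; rewrite x0 coords_ge0.
by rewrite mul0r ltxx.
Qed.

Lemma double_exists (s : {fset T}) :
  exists d : {fset T * bool}, forall q, (q \in d) = (q.1 \in s).
Proof.
exists (s `*` [fset true; false])%fset => -[v b].
by rewrite !inE /=; case: b; rewrite ?orbT andbT.
Qed.

(** The prism map, obtained by normalizing [prism_weight]. *)
Lemma prism_exists : exists F : realization R D * R -> realization R Cyl,
  [/\ forall p q, q \in finsupp (F p) -> 0 < prism_weight p q &
      forall s x (t : R), closed_simplex s x ->
        F @ prism_filter setT s x t --> F (x, t)].
Proof.
have [double in_double] := choice double_exists.
pose total_weight s p := \sum_(q <- double s) prism_weight p q.
have out s (p : realization R D * R) q : closed_simplex s p.1 -> q \notin double s ->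
    prism_weight p q = 0.
  move=> sp; rewrite in_double => qs.
  by rewrite /prism_weight (coords_out sp qs) mul0r.
have totalE s p : closed_simplex s p.1 ->
    total_weight (finsupp p.1) p = total_weight s p.
  move=> sp; apply: big_fset_incl => [|q _]; last by apply: out; exact: fsubset_refl.
  by apply/fsubsetP => q; rewrite !in_double; exact: (fsubsetP sp).
have total_gt0 s p : closed_simplex s p.1 -> 0 < total_weight s p.
  move=> sp; rewrite -totalE // /total_weight.
  suff [q qx wq] : exists2 q, q.1 \in finsupp p.1 & 0 < prism_weight p q.
    rewrite (big_fsetD1 q) ?in_double //= ltr_wpDr // sumr_ge0 // => q' _.
    exact: prism_weight_ge0.
  have [v vp] := finsupp_neq0 p.1; have v0 : 0 < p.1 v by rewrite coords_gt0.
  have mE := mass_le_lt vp.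
  (* The interval of [v] has positive length, so [1 - p.2] lies strictly above its left end or
     strictly below its right end. *)
  have [lt_t|ge_t] := ltP (mass_lt p.1 v) (1 - p.2).
    by exists (v, false) => //; rewrite prism_weight_gt0 /= vp subr_gt0.
  by exists (v, true) => //; rewrite prism_weight_gt0 /= vp subr_gt0 mE; lra.
have H p : exists z : realization R Cyl,
    forall q, z q = prism_weight p q / total_weight (finsupp p.1) p.
  have [|||z zE] := @point_exists R _ Cyl (double (finsupp p.1)) (prism_weight p).
  - by move=> q _; exact: prism_weight_ge0.
  - apply/not_exists2P => h; have := total_gt0 _ p (fsubset_refl _).
    rewrite /total_weight big_seq big1 ?ltxx // => q qd; apply/eqP.
    by rewrite eq_le prism_weight_ge0 andbT leNgt; apply/negP; case: (h q).
  - have gt0 q : prism_weight p q != 0 -> 0 < prism_weight p q.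
      by rewrite lt_def prism_weight_ge0 andbT.
    split.
      apply/eqP => s0; have := total_gt0 _ p (fsubset_refl _).
      rewrite /total_weight big_seq big1 ?ltxx // => q qd; apply/eqP/negPn/negP => wq.
      have : q \in fset0 by rewrite -s0 !inE /= qd.
      by rewrite inE.
    (* Both weights being positive gives [mass_lt p.1 v] < [1 - p.2] < [mass_le p.1 u], which
       [mass_mono] excludes when [u] is strictly below [v]. *)
    have key u v : (u, true) \in [fset q in double (finsupp p.1) | prism_weight p q != 0]%fset ->
        (v, false) \in [fset q in double (finsupp p.1) | prism_weight p q != 0]%fset -> le v u.
      rewrite !inE /= => /andP[_ /gt0]; rewrite prism_weight_gt0 /= => /andP[ux hu].
      move=> /andP[_ /gt0]; rewrite prism_weight_gt0 /= => /andP[vx hv].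
      have [_ /(_ u v ux vx)/orP[uv|//]] := iffLR (D_chain _) (coords_simplex p.1).
      have [->|nuv] := eqVneq u v; first exact: leT_refl.
      by have := mass_mono p.1 uv nuv; lra.
    have proj q : q \in [fset q in double (finsupp p.1) | prism_weight p q != 0]%fset ->
        q.1 \in finsupp p.1.
      by rewrite !inE /= in_double => /andP[].
    have cmp u v : u \in finsupp p.1 -> v \in finsupp p.1 -> le u v || le v u.
      by have [_] := iffLR (D_chain _) (coords_simplex p.1); exact.
    move=> [u [|]] [v [|]] uq vq; rewrite /cylinder_le /= ?andbT ?andbF ?orbF /=.
    + exact: cmp (proj _ uq) (proj _ vq).
    + exact: key uq vq.
    + by rewrite (key _ _ vq uq).
    + exact: cmp (proj _ uq) (proj _ vq).
  exists z => q; rewrite zE; case: ifPn => // qd.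
  by rewrite (out _ _ _ (fsubset_refl _) qd) mul0r.
have [F FE] := choice H; exists F; split.
  move=> p q; rewrite mem_finsupp FE mulf_eq0 negb_or => /andP[w0 _].
  by rewrite lt_def w0 prism_weight_ge0.
move=> s x t sx.
have sub p : closed_simplex s p.1 -> closed_simplex (double s) (F p).
  move=> sp; apply/fsubsetP => q; rewrite mem_finsupp FE mulf_eq0 negb_or => /andP[w0 _].
  by apply: contraR w0 => /(out s p _ sp) ->.
apply: (@cvg_realization _ _ _ _ _ _ _ (double s)).
- exact: sub.
- by apply: filterS (prism_near _ _ _ _) => p [_ sp _]; exact: sub.
move=> q0 _; rewrite FE (totalE s (x, t) sx).
apply: cvg_trans (_ : (fun p => prism_weight p q0 / total_weight s p) @ prism_filter setT s x t --> _).
  apply: near_eq_cvg; apply: filterS (prism_near _ _ _ _) => p [_ sp _].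
  by rewrite FE (totalE s p sp).
have cw q : prism_weight^~ q @ prism_filter setT s x t --> prism_weight (x, t) q.
  have c2 := @prism_snd _ _ _ setT s x t.
  have c3 : (fun p : realization R D * R => 1 - p.2) @ prism_filter setT s x t --> 1 - t.
    by apply: cvgB => //; exact: cvg_cst.
  have c1 (P : T -> pred T) v : (fun p : realization R D * R =>
      \sum_(u <- finsupp p.1 | P v u) p.1 u) @ prism_filter setT s x t -->
      \sum_(u <- finsupp x | P v u) x u.
    apply: (@cvg_comp _ _ _ fst (fun z : realization R D =>
      \sum_(u <- finsupp z | P v u) z u) _ (euclid s x)); last exact: mass_cvg.
    exact: prism_fst.
  apply: cvgM; first exact: prism_coords.
  apply: cvg_maxr; first exact: cvg_cst.
  case: q => v [] /=; apply: cvgB => //.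
  - exact: (c1 (fun v u => le u v)).
  - exact: (c1 (fun v u => le u v && (u != v))).
apply: cvgM; first exact: cw.
apply: cvgV; first by rewrite gt_eqF ?total_gt0.
by apply: cvg_sumr => q _ _; exact: cw.
Qed.

Lemma prism_slice (Y : topologicalType) (H : realization R D * R -> Y) s x (t : R) :
  0 <= t <= 1 -> H @ prism_filter setT s x t --> H (x, t) ->
  (fun y => H (y, t)) @ euclid s x --> H (x, t).
Proof.
move=> t01; apply: (@cvg_comp _ _ _ (fun y => (y, t))).
move=> A [[B1 B2] [/= nB1 nB2] BA].
suff : \forall y \near euclid s x, A (y, t) by [].
apply: (@filterS _ (euclid s x) _ _ _ _ nB1) => y By.
by apply: (BA (y, t)); split=> /=; [exact: By|exact: (nbhs_singleton nB2)].
Qed.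

Context (A : set T).
Local Notation lower v := [set z : realization R D | forall u, u \in finsupp z -> A u /\ le u v].
Context (contr : forall v, ~ A v -> exists (c : realization R D * R -> realization R D) y,
  contracts (lower v) c y).

(** The map [r] is the time-0 end of the contraction map after the prism map. Only level false has
    weight at time 0, which keeps values over [A]; only level true has weight at time 1, where
    supports do not grow. *)
Lemma deformation : exists r : realization R D -> realization R D,
  [/\ continuous r, homotopic R r idfun,
      forall (x : realization R D) v, v \in finsupp (r x) -> A v &
      forall x : realization R D, [set` finsupp x] `<=` A -> (finsupp (r x) `<=` finsupp x)%fset].
Proof.
(* The fold needs some initial point [x0], so the empty realization is treated apart. *)
have [[x0 _]|nx] := pselect (exists x : realization R D, True); last first.
  have ab (x : realization R D) : False by apply: nx; exists x.
  exists idfun; split=> //; exists fst; split=> //.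
  by apply: homotopy_continuous => s x; case: (ab x).
pose B (q : T * bool) : set T := [set u | (~~ q.2 -> A u) /\ le u q.1].
pose C (q : T * bool) : set (realization R D) := [set z | [set` finsupp z] `<=` B q].
(* On level true, and over vertices of [A], [C q] is a cone with apex [q.1], and contracting it adds
   only this vertex to supports. In the remaining case the assumed contraction of the fiber is
   used. *)
have H q : exists cy : (realization R D * R -> realization R D) * realization R D,
    contracts (C q) cy.1 cy.2 /\ (q.2 \/ A q.1 -> finsupp cy.2 = [fset q.1]%fset /\
    forall z t, C q z -> 0 <= t <= 1 ->
      (finsupp (cy.1 (z, t)) `<=` q.1 |` finsupp z)%fset).
  have [qA|nqA] := pselect (q.2 \/ A q.1); last first.
    have [/negP q2 nA] : ~ q.2 /\ ~ A q.1 by split=> h; apply: nqA; [left|right].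
    have [c [y cy]] := contr nA; exists (c, y); split=> //=.
    rewrite (_ : C q = lower q.1) //; apply/seteqP; split=> z /= zB u uz.
      by have [Au uq] := zB u uz; split => //; exact: Au.
    by have [Au uq] := zB u uz; split.
  have Dq : simplices D [fset q.1]%fset.
    apply/D_chain; split; first by apply/fset0Pn; exists q.1; rewrite inE.
    by move=> u v; rewrite !inE => /eqP -> /eqP ->; rewrite leT_refl.
  have [y yE] := @vertex_exists R _ D _ Dq.
  have coneq s : simplices D s -> [set` s] `<=` B q -> simplices D (s `|` finsupp y)%fset.
    move=> /D_chain[s0 sc] sB; rewrite yE; apply/D_chain; split.
      by apply/fset0Pn; exists q.1; rewrite !inE eqxx orbT.
    move=> u v; rewrite !inE => /orP[us|/eqP ->] /orP[vs|/eqP ->].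
    - exact: sc.
    - by have [_ ->] := sB u us.
    - by have [_ ->] := sB v vs; rewrite orbT.
    - by rewrite leT_refl.
  exists ((fun p => seg p.1 y p.2), y); split=> /=.
    apply: cone_contracts coneq => u; rewrite /= yE inE => /eqP ->; split=> //.
    by case: qA => // ->.
  move=> _; split=> // z t Cz t01; rewrite fsetUC -yE; apply: finsupp_seg => //.
  by apply: coneq => //; exact: coords_simplex.
have [cy cyP] := choice H.
pose c q := (cy q).1; pose y q := (cy q).2.
have C_mono q q' : cylinder_le le q q' -> C q `<=` C q'.
  move=> /andP[qq' /implyP bb'] z zB u uz; have [Au uq] := zB u uz; split.
    by move=> nb'; apply: Au; apply: contra nb' => /bb'.
  exact: leT_trans uq qq'.
have cyl_anti : antisymmetric (cylinder_le le).
  move=> [u a] [v b] /andP[/andP[/= uv ab] /andP[/= vu ba]]; congr pair.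
    by apply: leT_anti; rewrite uv.
  by case: a ab ba => //=; case: b.
have cyl_trans : transitive (cylinder_le le).
  move=> [v b] [u a] [w d] /andP[/= uv /implyP ab] /andP[/= vw /implyP bd].
  by rewrite /cylinder_le /= (leT_trans uv vw); apply/implyP => /ab/bd.
have cC q : contracts (C q) (c q) (y q) by have [] := cyP q.
pose h := @contract_map R _ (cylinder_le le) _ x0 c y Cyl.
have ch : continuous h.
  apply: (@continuous_contract_map R _ (cylinder_le le) cyl_anti cyl_trans _ x0 C c y C_mono cC).
  by move=> s [].
have carrier (Z : set (realization R D)) (z : realization R Cyl) : (forall q, q \in finsupp z -> Z (y q)) ->
    (forall q a t, q \in finsupp z -> 0 <= t <= 1 -> C q a -> Z a -> Z (c q (a, t))) -> Z (h z).
  apply: (@contract_map_carrier R _ (cylinder_le le) cyl_trans _ x0 C c y C_mono cC).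
  by move=> s [].
have [F [Fsupp Fcvg]] := prism_exists.
pose r (t : R) (x : realization R D) := h (F (x, t)).
have crt s x (t : R) : closed_simplex s x -> (h \o F) @ prism_filter setT s x t --> (h \o F) (x, t).
  by move=> sx; apply: (continuous_cvg _ (@ch _)); exact: Fcvg.
have cr t : 0 <= t <= 1 -> continuous (r t).
  move=> t01; apply: continuous_realization => s x _ sx.
  by apply: (@prism_slice _ (h \o F)) => //; exact: crt.
(* If only cone contractions occur, the vertices they add are apexes already in the support of
   [x]. *)
have shrinks t x : (forall q, q \in finsupp (F (x, t)) -> q.2 \/ A q.1) ->
    (finsupp (r t x) `<=` finsupp x)%fset.
  move=> qA; apply: (carrier [set z | (finsupp z `<=` finsupp x)%fset]) => /=.
    move=> q qF; have [_ /(_ (qA q qF))[-> _]] := cyP q; rewrite fsub1set.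
    by have := Fsupp _ _ qF; rewrite prism_weight_gt0 => /andP[].
  move=> q a u qF u01 Ca ax; have [_ /(_ (qA q qF))[_ qc]] := cyP q.
  apply: fsubset_trans (qc a u Ca u01) _; rewrite fsubUset ax andbT fsub1set.
  by have := Fsupp _ _ qF; rewrite prism_weight_gt0 => /andP[].
have level0 (x : realization R D) q : q \in finsupp (F (x, 0)) -> q.1 \in finsupp x /\ ~~ q.2.
  move=> /Fsupp; rewrite prism_weight_gt0 /= => /andP[qx]; case: q.2 => // h0; exfalso.
  by have := mass_le_le1 x q.1; lra.
have level1 (x : realization R D) q : q \in finsupp (F (x, 1)) -> q.2.
  move=> /Fsupp; rewrite prism_weight_gt0 /= => /andP[qx]; case: q.2 => // h0; exfalso.
  by have := mass_lt_ge0 x q.1; lra.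
exists (r 0); split.
- by apply: cr; rewrite lexx ler01.
- apply: (@homotopic_trans _ _ _ _ (r 1)).
    exists (h \o F); split=> //.
    by apply: homotopy_continuous => s x t _ sx _; exact: crt.
  have [||//] := @homotopic_shrink _ _ _ (r 1).
    by apply: cr; rewrite ler01 lexx.
  by move=> x; apply: shrinks => q /level1; left.
- move=> x v vr.
  suff : [set` finsupp (r 0 x)] `<=` A by apply.
  apply: (carrier [set z | [set` finsupp z] `<=` A]) => /= q.
    move=> /level0[_ q2] u uy; have [Cy _ _ _ _] := cC q.
    by have [Au _] := Cy u uy; exact: Au.
  move=> a t /level0[_ q2] t01 Ca _ u uc; have [_ Cc _ _ _] := cC q.
  by have [Au _] := Cc a t Ca t01 u uc; exact: Au.
- by move=> x xA; apply: shrinks => q /level0[qx _]; right; exact: xA.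
Qed.

End Deformation.

(** * The fiber lemma *)

Section FiberEquivalence.
Context (R : realType) (V T : choiceType) (le : rel T).
Context (leT_refl : reflexive le).
Context (leT_anti : antisymmetric le).
Context (leT_trans : transitive le).
Context (E : simplicialComplex V) (D : simplicialComplex T) (i : simplicialMap E D).
Context (D_chain : forall s, simplices D s <-> s != fset0 /\ {in s &, total le}).
Context (i_inj : injective i).
Context (i_full : forall s, s != fset0 -> simplices D (i @` s)%fset -> simplices E s).

(* Quillen's fiber lemma for full subcomplexes; the fiber over v is presented as
   the image of a contractible complex. *)
Lemma fiber_equivalence :
  (forall v, ~ range i v -> exists (W : choiceType) (F : simplicialComplex W)
    (j : simplicialMap F D),
    [/\ injective j,
        forall s, s != fset0 -> simplices D (j @` s)%fset -> simplices F s,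
        forall u, range j u <-> range i u /\ le u v
      & contractible R (realization R F)]) ->
  homotopy_equivalence R (realization_map R i).
Proof.
move=> fib; have [|r [cr rid rA rS]] := deformation (R := R) leT_refl leT_anti leT_trans D_chain (A := range i).
  move=> v /fib[W [F [j [j_inj j_full jE ctr]]]].
  have [c [y cy]] := contracts_range j_inj j_full ctr; exists c, y.
  rewrite (_ : [set z | _] = range (realization_map R j)) //.
  apply/seteqP; split=> z.
    by move=> zE; apply/(realization_map_rangeP j_inj j_full) => u /zE/jE.
  by move=> /(realization_map_rangeP j_inj j_full) zE u /zE/jE.
(* The deformation has values in the full subcomplex, so it factors as [i] after some [g], which is
   the homotopy inverse. *)
have H x : exists z, realization_map R i z = r x.
  by have /(realization_map_rangeP i_inj i_full)[z _ zE] := rA x; exists z.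
have [g gE] := choice H.
have ig : realization_map R i \o g = r by apply/funext.
split; first exact: continuous_realization_map.
have cg : continuous g.
  move=> x; apply: (embedding_cvg i_inj i_full (G := nbhs x)).
  by rewrite gE ig; exact: cr.
exists g; split=> //; last by rewrite ig.
(* On points of the subcomplex [r] does not enlarge supports; by injectivity of [i], neither does
   [g] after [i]. *)
apply: (@homotopic_shrink _ _ _ _ _ _).1.
  by move=> x; apply: continuous_comp; [exact: continuous_realization_map|exact: cg].
move=> x; apply/fsubsetP => v vx.
have : i v \in finsupp (realization_map R i x).
  apply: (fsubsetP (rS _ _)).
    by move=> u /=; rewrite finsupp_realization_map => /imfsetP[w _ ->]; exists w.
  by rewrite -gE finsupp_realization_map in_imfset.
by rewrite finsupp_realization_map => /imfsetP[w /= wx /i_inj ->].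
Qed.

End FiberEquivalence.

(** * Full simplices on arbitrary vertex sets *)

Section FullSimplex.
Context (V : choiceType) (B : set V).

Definition full_simplices : set {fset V} := [set s | s != fset0 /\ [set` s] `<=` B].

Lemma full_simplices_neq0 s : full_simplices s -> s != fset0.
Proof. by case. Qed.

Lemma full_simplices_face (s t : {fset V}) :
  full_simplices s -> (t `<=` s)%fset -> t != fset0 -> full_simplices t.
Proof. by move=> [_ sB] /fsubsetP ts t0; split=> // v /ts; exact: sB. Qed.

Definition full_simplex := SimplicialComplex full_simplices_neq0 full_simplices_face.

(** A full simplex is a cone with apex any of its vertices. *)
Lemma full_simplex_contractible (R : realType) :
  B !=set0 -> contractible R (realization R full_simplex).
Proof.
move=> [v Bv]; have Fv : simplices full_simplex [fset v]%fset.
  split; first by apply/fset0Pn; exists v; rewrite inE.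
  by move=> u /=; rewrite inE => /eqP ->.
have [y yE] := @vertex_exists R _ _ _ Fv.
have := @cone_contracts R _ full_simplex setT y.
rewrite (_ : [set z : realization R full_simplex | _] = setT); last first.
  by apply/seteqP; split.
move=> h; apply: contracts_contractible (h _ _) => // s [s0 sB] _; rewrite yE; split.
  by apply/fset0Pn; exists v; rewrite !inE eqxx orbT.
by move=> u /=; rewrite !inE => /orP[/sB|/eqP ->].
Qed.

End FullSimplex.

(** * The two inclusions into the relational join *)

Theorem theorem3p27 (R : realType) (V : choiceType) (K : simplicialComplex V)
    (U : set (simplicialComplex V)) (goodU : good_cover R K U) :
  homotopy_equivalence R
    (realization_map R (order_complex_map (rjoin_inl (covering_relation K U)))) /\
  homotopy_equivalence R
    (realization_map R (order_complex_map (rjoin_inr (covering_relation K U)))).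
Proof.
have [[UK Ucov] good] := goodU.
set J := relational_join (covering_relation K U).
split.
- apply: (@fiber_equivalence _ _ _ (fun x y : J => (x <= y)%O)).
  + exact: lexx.
  + exact: le_anti.
  + exact: le_trans.
  + by [].
  + by move=> p p' [].
  + move=> s s0 [_ sP]; split=> // p p' ps p's.
    by apply: (sP (inl p) (inl p')); exact: in_imfset.
  move=> [p|q] nr; first by exfalso; apply: nr; exists p.
  have [q0 qU qne] : nerve_simplices U (sval q) by have := valP q; rewrite inE.
  (* The elements of P_K below [q] are the simplices common to all members of [q], that is, the
     faces of this complex. *)
  pose L := intersection_complex (sval q).
  have LK (s : face_poset L) : sval s \in simplices K.
    have /fset0Pn[M Mq] := q0; have := valP s; rewrite !inE => -[_ /(_ M Mq)].
    exact: (UK M (qU M Mq)).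
  pose j (s : face_poset L) : J := inl (exist _ (sval s) (LK s)).
  have jP c : simplices (order_complex (face_poset L)) c ->
      simplices (order_complex J) (j @` c)%fset.
    move=> [/fset0Pn[x xc] cP]; split.
      by apply/fset0Pn; exists (j x); rewrite in_imfset.
    by move=> _ _ /imfsetP[y /= yc ->] /imfsetP[z /= zc ->]; exact: cP.
  exists (face_poset L), (order_complex (face_poset L)), (SimplicialMap jP); split=> /=.
  + by move=> s t [st]; exact: val_inj.
  + move=> c c0 [_ cP]; split=> // s t sc tc.
    by apply: (cP (j s) (j t)); exact: in_imfset.
  + move=> u; split.
      move=> [s _ <-]; split; first by exists (exist _ (sval s) (LK s)).
      by rewrite inE => M Mq; have := valP s; rewrite inE => -[_]; exact.
    move=> [[p _ <-]]; rewrite inE => pq.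
    have Lp : sval p \in simplices L.
      by rewrite inE; split=> //; exact: face_neq0.
    by exists (exist _ (sval p) Lp) => //; congr inl; exact: val_inj.
  + apply: subdivision_contractible; exact: good.
(* Reversing the order turns the elements of the nerve part above a simplex [p] into the fiber under
   [p]. *)
- apply: (@fiber_equivalence _ _ _ (fun x y : J => (y <= x)%O)).
  + exact: lexx.
  + by move=> x y; rewrite andbC; exact: le_anti.
  + by move=> y x z yx zy; exact: le_trans zy yx.
  + by move=> s; split=> -[s0 sP]; split=> // x y xs ys; exact: (sP y x).
  + by move=> q q' [].
  + move=> s s0 [_ sP]; split=> // q q' qs q's.
    by apply: (sP (inr q) (inr q')); exact: in_imfset.
  move=> [p|q] nr; last by exfalso; apply: nr; exists q.
  have Kp : simplices K (sval p) by have := valP p; rewrite inE.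
  (* Any finite non-empty set of cover members containing [p] is a simplex of the nerve, with [p]
     witnessing the common intersection. *)
  pose L := full_simplex [set M : simplicialComplex V | U M /\ simplices M (sval p)].
  have LN (s : face_poset L) : sval s \in simplices (nerve U).
    have := valP s; rewrite !inE => -[s0 sB]; split=> //.
      by move=> M /sB[].
    exists (sval p); split; first exact: face_neq0.
    by move=> M /sB[].
  pose j (s : face_poset L) : J := inr (exist _ (sval s) (LN s) : face_poset (nerve U)).
  have jP c : simplices (order_complex (face_poset L)) c ->
      simplices (order_complex J) (j @` c)%fset.
    move=> [/fset0Pn[x xc] cP]; split.
      by apply/fset0Pn; exists (j x); rewrite in_imfset.
    move=> _ _ /imfsetP[y /= yc ->] /imfsetP[z /= zc ->]; rewrite comparable_sym; exact: cP.
  exists (face_poset L), (order_complex (face_poset L)), (SimplicialMap jP); split=> /=.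
  + by move=> s t [st]; exact: val_inj.
  + move=> c c0 [_ cP]; split=> // s t sc tc; rewrite comparable_sym.
    by apply: (cP (j s) (j t)); exact: in_imfset.
  + move=> u; split.
      move=> [s _ <-]; split; first by exists (exist _ (sval s) (LN s)).
      rewrite /= /Order.le /= inE => M Ms; have := valP s; rewrite inE => -[_ sB].
      by have [] := sB M Ms.
    move=> [[q _ <-]]; rewrite /= /Order.le /= inE => pq.
    have Lq : sval (q : face_poset (nerve U)) \in simplices L.
      have := valP (q : face_poset (nerve U)); rewrite !inE => -[q0 qU _].
      by split=> // M Mq; split; [exact: qU|exact: pq].
    by exists (exist _ (sval (q : face_poset (nerve U))) Lq) => //; congr inr; exact: val_inj.
  + apply/subdivision_contractible/full_simplex_contractible.
    (* The covering property provides a vertex of this full simplex. *)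
    have [M UM Mp] : (\bigcup_(M in U) simplices M) (sval p) by rewrite Ucov.
    by exists M.
Qed.
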